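(* Let $n\ge 3$ and $\ell\ge 1$ be integers with $n$ odd, and let $(P_n^\ell,S_E)$ be an edge-signed map on the $(n,\ell)$-pancake $P_n^\ell$ such that $S_E(v)=S_E(-v)$ for each pair $v,-v$ of antipodal vertices of $med(P_n^\ell)$. Then $L(P_n^\ell,S_E)$ is amphichiral.
   Context: Maps. A map $G=(V,E,F)$ is (the image of) an embedding in $\mathbb{S}^2$ of a connected finite planar graph. $G^*$ is its geometric dual. An edge-signed map $(G,S_E)$ is a map with a function $S_E:E\to\{+,-\}$. For $n\ge3$, $\ell\ge1$, the $(n,\ell)$-pancake $P_n^\ell$ is the plane graph consisting of $\ell$ (concentric) cycles $\{v_1^1,\dots,v_n^1\},\dots,\{v_1^\ell,\dots,v_n^\ell\}$, a central vertex $v_0$, and the edges $\{v_i^{j-1},v_i^j\}$ for all $1\le j\le \ell$ and $1\le i\le n$, where $v_i^0=v_0$ for all $i$. Medial map. $med(G)$ is the 4-regular map with one vertex on each edge of $G$, two vertices being joined when the corresponding edges are consecutive on a face of $G$. Faces of $med(G)$ containing a vertex of $G$ are colored black, those containing a vertex of $G^*$ white. For a vertex $v$ of $med(G)$ lying on an edge $e$ of $G$ we write $S_E(v)=S_E(e)$. Antipodal vertices. Let $\alpha_2:\mathbb{S}^2\to\mathbb{S}^2$, $x\mapsto -x$. It is known that for odd $n\ge3$ the map $P_n^\ell$ is antipodally self-dual, i.e. it can be drawn in $\mathbb{S}^2$ so that $\alpha_2(P_n^\ell)=(P_n^\ell)^*$, and that then $med(P_n^\ell)$ is drawn with $\alpha_2(med(P_n^\ell))=med(P_n^\ell)$.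 The antipodal pairs of vertices of $med(P_n^\ell)$ are the pairs $v$, $-v=\alpha_2(v)$ in this drawing. Links. $D(G,S_E)$ is the link diagram on $\mathbb{S}^2$ with shadow $med(G)$; the crossing on an edge $e$ has sign $S_E(e)$, where for an observer in a black face at a crossing, looking at the crossing (from outside the sphere), a positive crossing is one where the strand on the observer's left passes over the one on the right, a negative crossing is the opposite. $L(G,S_E)$ is the link in $\mathbb{R}^3$ represented by $D(G,S_E)$. Two links in $\mathbb{R}^3$ are equivalent if an orientation-preserving homeomorphism of $\mathbb{R}^3$ maps one onto the other. The mirror image $L^*$ of $L$ is its image under reflection in a plane. $L$ is amphichiral if $L$ is equivalent to $L^*$. *)

(* Defs.v *)
From HB Require Import structures.
From mathcomp Require Import all_boot all_order all_algebra.
From mathcomp Require Import all_classical all_reals all_analysis.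
From mathcomp Require Import zify ring lra.

Set Implicit Arguments.
Unset Strict Implicit.
Unset Printing Implicit Defensive.

Import Order.TTheory GRing.Theory Num.Theory.
Import numFieldNormedType.Exports.

Local Open Scope classical_set_scope.
Local Open Scope ring_scope.

Notation space3 R := 'rV[R]_3.

Definition vec3 (R : realType) (x y z : R) : space3 R :=
  \row_j [:: x; y; z]`_j.

Definition sphere (R : realType) : set (space3 R) :=
  [set x | \sum_j x 0 j ^+ 2 = 1].

Definition antipode (R : realType) (x : space3 R) : space3 R := - x.

(* The minor great-circle arc from u to v, for u, v on the sphere, v != -u. *)
Definition garc (R : realType) (u v : space3 R) : set (space3 R) :=
  @sphere R `&` [set x | exists a b, [/\ 0 <= a, 0 <= b & x = a *: u + b *: v]].

(** * Links in R^3 *)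

Definition homeomorphism (R : realType) (f : space3 R -> space3 R) : Prop :=
  exists g : space3 R -> space3 R,
    [/\ cancel f g, cancel g f, continuous f & continuous g].

(* Degree +1 at the origin: x |-> f x - f 0 is homotopic to the identity among
   maps of R^3 \ {0} into itself, i.e. it acts as +1 on H_2(R^3 \ {0}). *)
Definition orientation_preserving (R : realType) (f : space3 R -> space3 R) :
    Prop :=
  exists H : R * space3 R -> space3 R,
    [/\ {within `[0%R, 1%R] `*` [set x | x != 0], continuous H},
        forall t x, 0 <= t <= 1 -> x != 0 -> H (t, x) != 0,
        forall x, x != 0 -> H (0, x) = f x - f 0 &
        forall x, x != 0 -> H (1, x) = x].

Definition equivalent (R : realType) (K L : set (space3 R)) : Prop :=
  exists f : space3 R -> space3 R,
    [/\ homeomorphism f, orientation_preserving f & f @` K = L].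

(* Reflection in the plane z = 0; another plane gives an equivalent image. *)
Definition reflection (R : realType) (x : space3 R) : space3 R :=
  vec3 (x 0 0) (x 0 1) (- x 0 2%R).

Definition mirror (R : realType) (L : set (space3 R)) : set (space3 R) :=
  @reflection R @` L.

Definition amphichiral (R : realType) (L : set (space3 R)) : Prop :=
  equivalent L (mirror L).

(** * Maps on the sphere *)

(* Drawing data of a map.  A dart (e, b) is the edge e with a direction, b =
   false being the reference one; [ccw d] is the next dart counterclockwise,
   seen from outside the sphere, around the vertex [org d]; [lface d] is the
   face to the left of d.  A vertex v is drawn at [vpt v]; the edge e passes through
   [ept e], which is also the vertex of the medial map lying on e; the dual
   vertex in the face f is [fpt f].  A half-edge of the map or of its dual is
   the great-circle arc from the end to [ept e].
   That these data form an embedding is not a field: the only inhabitant used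
   is [pancake] below. *)
Record smap (R : realType) := SMap {
  vert : finType;
  edge : finType;
  face : finType;
  org : edge * bool -> vert;
  ccw : edge * bool -> edge * bool;
  lface : edge * bool -> face;
  vpt : vert -> space3 R;
  ept : edge -> space3 R;
  fpt : face -> space3 R }.

Definition dart (R : realType) (G : smap R) : finType := (edge G * bool)%type.

Definition flip (R : realType) (G : smap R) (d : dart G) : dart G :=
  (d.1, ~~ d.2).

Definition carrier (R : realType) (G : smap R) : set (space3 R) :=
  \bigcup_(d in [set: dart G]) garc (vpt (org d)) (ept d.1).

Definition dual_carrier (R : realType) (G : smap R) : set (space3 R) :=
  \bigcup_(d in [set: dart G]) garc (fpt (lface d)) (ept d.1).

(* The edges of the medial map correspond to the corners of G, that is to its
   darts d, the corner being the one between d and [ccw d] at [org d]. *)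
Definition med_arc (R : realType) (G : smap R) (d : dart G) : set (space3 R) :=
  garc (ept d.1) (ept (ccw d).1).

Definition med_carrier (R : realType) (G : smap R) : set (space3 R) :=
  \bigcup_(d in [set: dart G]) med_arc d.

(** * Link diagrams of edge-signed maps *)

Variant sign := Plus | Minus.

(* [lies_over S L]: seen from outside the sphere, i.e. by radial projection with
   the point further from the origin on top, L has the diagram D(G, S).  Here
   [h d] is the distance to the origin of the part of L above [med_arc d].
   Let [ccw c = d].  At the crossing [ept d.1], an observer standing in the
   black face of [org d] and looking along d sees the medial arc of the corner d
   on the left and that of the corner c on
   the right.  With [ccw c' = flip d], the left strand continues along the arc of
   the corner [flip d], opposite to that of d, and the right one along that of
   c'.  Replacing d by [flip d] gives the same condition.
   Such an L is a disjoint union of simple closed curves, since the heights of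
   the two strands at each crossing differ. *)
Definition lies_over (R : realType) (G : smap R) (S : edge G -> sign)
    (L : set (space3 R)) : Prop :=
  exists h : dart G -> space3 R -> R,
    [/\ forall d, {within med_arc d, continuous (h d)},
        forall d x, med_arc d x -> 0 < h d x,
        forall c d c' : dart G, ccw c = d -> ccw c' = flip d ->
          let v := ept d.1 in
          [/\ h d v = h (flip d) v, h c v = h c' v &
              match S d.1 with
              | Plus => h c v < h d v
              | Minus => h d v < h c v
              end] &
        L = \bigcup_(d in [set: dart G]) [set h d x *: x | x in med_arc d]].

(* L is a link of the equivalence class L(G, S). *)
Definition represents (R : realType) (G : smap R) (S : edge G -> sign)
    (L : set (space3 R)) : Prop :=
  exists2 K : set (space3 R), lies_over S K & equivalent K L.

(** * Pancakes *)

(* Colatitude a * pi / (2l + 1) and longitude b * pi / n. *)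
Definition grid (R : realType) (n l a b : nat) : space3 R :=
  let t := a%:R * pi / (l.*2.+1)%:R in
  let p := b%:R * pi / n%:R in
  vec3 (sin t * cos p) (sin t * sin p) (cos t).

(* 'I_n indexes the spokes cyclically, and the index j : 'I_l stands for the
   cycle of index j + 1.  [Some (i, j)] is a vertex of that cycle, [None] is the
   central vertex v_0.  [Ring i j] goes from (i, j) to (i + 1, j), that is
   eastwards; [Spoke i j] joins (i, j - 1), or v_0 if j = 0, to (i, j), that is
   southwards.  Of the faces, [Some (i, j)] lies between the spokes i and i + 1
   and just north of the cycle j, and [None] is the one south of the last
   cycle. *)
Notation pverts n l := (option ('I_n * 'I_l))%type.
Notation pedges n l := ('I_n * 'I_l + 'I_n * 'I_l)%type.
Notation Ring i j := (inl (i, j)).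
Notation Spoke i j := (inr (i, j)).

Definition pancake_org n l (d : pedges n l * bool) : pverts n l :=
  match d with
  | (Spoke i j, false) => if j == 0%N :> nat then None else Some (i, ord_pred j)
  | (Spoke i j, true)  => Some (i, j)
  | (Ring i j, false)  => Some (i, j)
  | (Ring i j, true)   => Some (ordS i, j)
  end.

Definition pancake_ccw n l (d : pedges n l * bool) : pedges n l * bool :=
  match d with
  | (Spoke i j, false) =>
      if j == 0%N :> nat then (Spoke (ordS i) j, false)
      else (Ring i (ord_pred j), false)
  | (Ring i j, false)  => (Spoke i j, true)
  | (Spoke i j, true)  => (Ring (ord_pred i) j, true)
  | (Ring i j, true)   =>
      if j.+1 == l then (Ring (ordS i) j, false)
      else (Spoke (ordS i) (ordS j), false)
  end.

Definition pancake_lface n l (d : pedges n l * bool) : pverts n l :=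
  match d with
  | (Spoke i j, false) => Some (i, j)
  | (Spoke i j, true)  => Some (ord_pred i, j)
  | (Ring i j, false)  => Some (i, j)
  | (Ring i j, true)   => if j.+1 == l then None else Some (i, ordS j)
  end.

(* The pancake drawn with v_0 at the north pole, the cycles on parallels and the
   spokes on meridians; for odd n this drawing is antipodally self-dual
   ([pancake_self_dual],
   [pancake_med_antipodal]). *)
Definition pancake (R : realType) (n l : nat) : smap R := {|
  vert := pverts n l;
  edge := pedges n l;
  face := pverts n l;
  org := @pancake_org n l;
  ccw := @pancake_ccw n l;
  lface := @pancake_lface n l;
  vpt := fun v => match v with
    | None => grid R n l 0 0
    | Some (i, j) => grid R n l j.+1.*2 i.*2
    end;
  ept := fun e => match e with
    | Ring i j => grid R n l j.+1.*2 i.*2.+1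
    | Spoke i j => grid R n l j.*2.+1 i.*2
    end;
  fpt := fun f => match f with
    | None => grid R n l l.*2.+1 0
    | Some (i, j) => grid R n l j.*2.+1 i.*2.+1
    end |}.

(** ** Antipodal self-duality of the drawing *)

Lemma garcN (R : realType) (u v x : space3 R) :
  garc u v x -> garc (- u) (- v) (- x).
Proof.
case=> sx [a [b [a0 b0 xE]]]; split.
  by move: sx; rewrite /sphere /= => <-; apply: eq_bigr => j _; rewrite mxE sqrrN.
by exists a, b; split=> //; rewrite xE !scalerN opprD.
Qed.

Lemma grid_opp (R : realType) (n l a b a' b' : nat) : (0 < n)%N ->
  (a + a' = l.*2.+1)%N ->
  (b + n = b' + n.*2 \/ b + n = b')%N -> - grid R n l a b = grid R n l a' b'.
Proof.
move=> n0 aE bE; rewrite /grid /=.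
have l0 : (l.*2.+1)%:R != 0 :> R by rewrite pnatr_eq0.
have n0' : n%:R != 0 :> R by rewrite pnatr_eq0 -lt0n.
set t := a%:R * _ / _; set p := b%:R * _ / _.
have -> : a'%:R * pi / (l.*2.+1)%:R = pi - t :> R.
  by rewrite /t; move: l0; rewrite -aE natrD => l0; field.
have st : sin (pi - t) = sin t.
  by rewrite sinB sinpi cospi mul0r sub0r mulN1r opprK.
have ct : cos (pi - t) = - cos t.
  by rewrite cosB sinpi cospi mul0r addr0 mulN1r.
have [sp cp] : sin (b'%:R * pi / n%:R) = - sin p /\
               cos (b'%:R * pi / n%:R) = - cos p.
  case: bE => bE; have := congr1 (fun k => k%:R : R) bE;
    rewrite -?muln2 ?natrD ?natrM => bR.
    have -> : b'%:R * pi / n%:R = p - pi :> R.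
      by rewrite /p (_ : b'%:R = b%:R - n%:R); [field | lra].
    by rewrite sinB cosB sinpi cospi; split; ring.
  rewrite -bR (_ : _ * pi / _ = p + pi) ?sinDpi ?cosDpi //.
  by rewrite /p; field.
rewrite st ct sp cp; apply/rowP => j; rewrite !mxE.
by case: j => [[|[|[|//]]] ?] /=; ring.
Qed.

Lemma pole_opp (R : realType) (n l b b' : nat) :
  - grid R n l 0 b = grid R n l l.*2.+1 b'.
Proof.
rewrite /grid /=.
have l0 : (l.*2.+1)%:R != 0 :> R by rewrite pnatr_eq0.
have e0 : 0%:R * pi / (l.*2.+1)%:R = 0 :> R by rewrite mulr0n !mul0r.
have e1 : (l.*2.+1)%:R * pi / (l.*2.+1)%:R = pi :> R.
  by rewrite (mulrC _ pi) mulfK.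
rewrite e0 e1 sinpi cospi sin0 cos0.
by apply/rowP => j; rewrite !mxE; case: j => [[|[|[|//]]] ?] /=; ring.
Qed.

(* The antipodal map on darts: it exchanges vertices and faces, and maps the
   corner at d to that at its image. *)
Lemma pancake_antipode (R : realType) (n l : nat) : odd n ->
  exists a : dart (pancake R n l) -> dart (pancake R n l),
    [/\ forall d, exists d', a d' = d,
        forall d, - ept d.1 = ept (a d).1,
        forall d, - vpt (org d) = fpt (lface (a d)) &
        forall d, - ept (ccw d).1 = ept (ccw (a d)).1].
Proof.
move=> on; have n0 : (0 < n)%N by case: n on.
have addP (i : 'I_n) k : ((i + k) %% n < n)%N by rewrite ltn_mod.
pose add (i : 'I_n) k : 'I_n := Ordinal (addP i k).
have lt_rev (j : 'I_l) : (l - j.+1 < l)%N by have := ltn_ord j; lia.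
pose rv (j : 'I_l) : 'I_l := Ordinal (lt_rev j).
have modE (i k : nat) : (i < n)%N -> (k <= n)%N ->
    ((i + k) %% n = if i + k < n then i + k else i + k - n)%N.
  move=> ? ?; case: ifP => h; first by rewrite modn_small.
  by rewrite -[in LHS](@subnK n (i + k)) ?modnDr ?modn_small //; lia.
have nE : (n = (n./2).*2.+1)%N by have := odd_double_half n; rewrite on.
have half_n : (n./2 <= n)%N by lia.
have half_n1 : (n./2.+1 <= n)%N by lia.
have succE (m i : nat) : (i < m)%N ->
    (i.+1 %% m = if i.+1 < m then i.+1 else 0)%N.
  move=> im; case: ltnP => h; first by rewrite modn_small.
  by rewrite (_ : i.+1 = m) ?modnn //; lia.
have predE (m i : nat) : (i < m)%N ->
    ((i + m).-1 %% m = if 0 < i then i.-1 else m.-1)%N.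
  move=> im; case: posnP => h; first by rewrite h add0n modn_small //; lia.
  by rewrite (_ : (i + m).-1 = i.-1 + m)%N ?modnDr ?modn_small //; lia.
pose a (d : dart (pancake R n l)) : dart (pancake R n l) :=
  match d with
  | (Spoke i j, b) => (Ring (add i n./2) (rv j), ~~ b)
  | (Ring i j, b) => (Spoke (add i n./2.+1) (rv j), ~~ b)
  end.
have aE d : - ept d.1 = ept (a d).1.
  case: d => [[[i j]|[i j]] b] /=; (apply: grid_opp => //;
    first (have := ltn_ord j; lia)); rewrite modE //;
    have := ltn_ord i; case: ifP; lia.
have aV d : - vpt (org d) = fpt (lface (a d)).
  case: d => [[[i j]|[i j]] []]; have jl := ltn_ord j; have il := ltn_ord i;
    rewrite /a /=.
  - apply: grid_opp => //=; first lia.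
    by rewrite succE // modE //; do 2 case: ifP; lia.
  - apply: grid_opp => //=; first lia.
    by rewrite predE ?ltn_mod // modE //; do 2 case: ifP; lia.
  - apply: grid_opp => //=; first lia.
    by rewrite modE //; case: ifP; lia.
  - case: (boolP (j == 0%N :> nat)) => j0; case: ifP => jl'; try lia.
      exact: pole_opp.
    apply: grid_opp => //=.
      by rewrite predE // succE //; do 2 case: ifP; lia.
    by rewrite modE //; case: ifP; lia.
have aK d : exists d', a d' = d.
  case: d => [[[i j]|[i j]] b].
    exists (Spoke (add i n./2.+1) (rv j), ~~ b); rewrite /a /= negbK.
    congr (Ring _ _, _); apply/val_inj => /=; last by have := ltn_ord j; lia.
    have := ltn_ord i; rewrite (modE i) //; case: ifP => h ?;
      rewrite modE //; try lia; case: ifP; lia.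
  exists (Ring (add i n./2) (rv j), ~~ b); rewrite /a /= negbK.
  congr (Spoke _ _, _); apply/val_inj => /=; last by have := ltn_ord j; lia.
  have := ltn_ord i; rewrite (modE i) //; case: ifP => h ?;
    rewrite modE //; try lia; case: ifP; lia.
exists a; split=> //.
case=> [[[i j]|[i j]] []]; have jl := ltn_ord j; have il := ltn_ord i;
  rewrite /a /=.
- case: (boolP (l - j.+1 == 0)%N) => j0; case: ifP => jl'; try lia;
    (apply: grid_opp => //=; last by rewrite ?succE ?ltn_mod // modE //;
      repeat case: ifP; lia).
    lia.
  by rewrite predE // succE //; repeat case: ifP; lia.
- apply: grid_opp => //=; first lia.
  by rewrite predE ?ltn_mod // modE //; repeat case: ifP; lia.
- apply: grid_opp => //=; first lia.
  by rewrite predE // modE ?ltn_mod //; repeat case: ifP; lia.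
- case: (boolP (j == 0%N :> nat)) => j0; case: ifP => jl'; try lia;
    (apply: grid_opp => //=; last by rewrite ?succE ?ltn_mod // ?modE ?ltn_mod //;
      repeat case: ifP; lia).
    lia.
  by rewrite predE // succE //; repeat case: ifP; lia.
Qed.

Lemma pancake_self_dual (R : realType) (n l : nat) : odd n ->
  @antipode R @` carrier (pancake R n l) = dual_carrier (pancake R n l).
Proof.
case/(@pancake_antipode R n l) => a [aK aE aV _].
apply/seteqP; split=> x /=.
  by case=> y [d _ yd] <-; exists (a d) => //; rewrite -aE -aV; exact: garcN.
case=> d _; have [d' <-] := aK d; rewrite -aE -aV => xd.
exists (- x); last by rewrite /antipode opprK.
by exists d' => //; have := garcN xd; rewrite !opprK.
Qed.

Lemma pancake_med_antipodal (R : realType) (n l : nat) : odd n ->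
  @antipode R @` med_carrier (pancake R n l) = med_carrier (pancake R n l).
Proof.
case/(@pancake_antipode R n l) => a [aK aE _ aC].
apply/seteqP; split=> x /=.
  by case=> y [d _ yd] <-; exists (a d) => //; rewrite /med_arc -aE -aC;
    exact: garcN.
case=> d _; have [d' <-] := aK d; rewrite /med_arc -aE -aC => xd.
exists (- x); last by rewrite /antipode opprK.
by exists d' => //; have := garcN xd; rewrite !opprK.
Qed.

(* Main.v *)
Require Import Defs.
From mathcomp Require Import all_boot all_order all_algebra.
From mathcomp Require Import all_classical all_reals all_analysis.
From mathcomp Require Import zify ring lra.

(** The antipodal map [x |-> -x] reverses the orientation of the sphere and, the
    drawing being antipodally self-dual, also exchanges the black and the white
    faces of the medial map.  The two effects on the signs of the crossings
    cancel, so if a link [K] has the diagram D(G, S) and S is invariant under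
    the antipodal map, then [-K] has the same diagram.

    Two links with the same diagram are equivalent by a homeomorphism preserving
    each ray from the origin: the increasing reparametrizations of a ray that
    take the heights of the first link to those of the second one form a convex
    set, so local solutions can be glued by weights.  Finally, [-K] is the image
    of the mirror image of [K] under a half turn. *)

Set Implicit Arguments.
Unset Strict Implicit.
Unset Printing Implicit Defensive.

Import Order.TTheory GRing.Theory Num.Theory.
Import numFieldNormedType.Exports.

Local Open Scope classical_set_scope.
Local Open Scope ring_scope.

(** * Homotopies and equivalence of links *)

Section Continuity.
Variables (R : realType) (T : topologicalType) (U : topologicalType).

Lemma continuous_at_paste (c : T -> bool) (f g : T -> U) p :
  {for p, continuous f} -> {for p, continuous g} -> f p = g p ->
  {for p, continuous (fun q => if c q then f q else g q)}.
Proof.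
move=> cf cg fg A /=; rewrite -fg if_same => nA.
have nA' := nA; rewrite fg in nA'.
change (\forall q \near p, A (if c q then f q else g q)).
near=> q; case: (c q).
  by near: q; exact: cf nA.
by near: q; exact: cg nA'.
Unshelve. all: by end_near. Qed.

Lemma continuous_at_near (f g : T -> U) p :
  (\forall q \near p, f q = g q) -> {for p, continuous f} ->
  {for p, continuous g}.
Proof.
move=> fg cf; rewrite /prop_for /continuous_at -(nbhs_singleton fg).
by apply: cvg_trans cf; exact: near_eq_cvg.
Qed.

End Continuity.

Lemma cvg_pair_nbhs (T : Type) (U W : topologicalType) (F : set_system T)
    (FF : Filter F) (f : T -> U) (g : T -> W) (a : U) (b : W) :
  f @ F --> a -> g @ F --> b -> (fun x => (f x, g x)) @ F --> (a, b).
Proof. by move=> fa gb; exact: (cvg_pair fa gb). Qed.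

Lemma cvg_app (T : Type) (U W : topologicalType) (F : set_system T)
    (FF : Filter F) (g : U -> W) (f : T -> U) (a : U) :
  {for a, continuous g} -> f @ F --> a -> (fun x => g (f x)) @ F --> g a.
Proof. by move=> cg fa; exact: continuous_cvg. Qed.

Lemma cvg_max (R : realType) (T : Type) (F : set_system T) (FF : Filter F)
    (f g : T -> R) (a b : R) : f @ F --> a -> g @ F --> b ->
  (fun x => Num.max (f x) (g x)) @ F --> Num.max a b.
Proof.
move=> fa gb; under eq_fun do rewrite maxr_absE; rewrite maxr_absE.
apply: cvgM; last exact: cvg_cst.
by apply: cvgD; [exact: cvgD | apply: cvg_norm; exact: cvgB].
Qed.

Lemma cvg_min (R : realType) (T : Type) (F : set_system T) (FF : Filter F)
    (f g : T -> R) (a b : R) : f @ F --> a -> g @ F --> b ->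
  (fun x => Num.min (f x) (g x)) @ F --> Num.min a b.
Proof.
move=> fa gb; under eq_fun do rewrite minr_absE; rewrite minr_absE.
apply: cvgM; last exact: cvg_cst.
by apply: cvgB; [exact: cvgD | apply: cvg_norm; exact: cvgB].
Qed.

Lemma cvg_bigsum (R : realType) (T : Type) (F : set_system T) (FF : Filter F)
    (I : finType) (f : I -> T -> R) (a : I -> R) :
  (forall i, f i @ F --> a i) ->
  (fun x => \sum_i f i x) @ F --> \sum_i a i.
Proof.
move=> fa; elim: (index_enum I) => [|i s IH].
  by rewrite big_nil; under eq_fun do rewrite big_nil; exact: cvg_cst.
rewrite big_cons; under eq_fun do rewrite big_cons.
exact: cvgD (fa i) IH.
Qed.

Section Homotopy.
Variable R : realType.
Notation V := (space3 R).
Implicit Types (F G : V -> V) (H : R * V -> V) (K L : set V).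

Definition homotopic F G := exists H,
  [/\ forall t x, x != 0 -> {for (t, x), continuous H},
      forall t x, x != 0 -> H (t, x) != 0,
      forall x, x != 0 -> H (0, x) = F x &
      forall x, x != 0 -> H (1, x) = G x].

Definition clamp (t : R) : R := Num.max 0 (Num.min t 1).

Lemma clamp_continuous : continuous clamp.
Proof.
move=> t; apply: cvg_max; first exact: cvg_cst.
by apply: cvg_min; [exact: cvg_id | exact: cvg_cst].
Qed.

Lemma clamp_itv t : 0 <= clamp t <= 1.
Proof. by rewrite /clamp le_max lexx ge_max ler01 ge_min lexx orbT. Qed.

Lemma clamp_id t : 0 <= t <= 1 -> clamp t = t.
Proof. by case/andP => t0 t1; rewrite /clamp (min_idPl t1) (max_idPr t0). Qed.

Lemma nonzero_near (x : V) : x != 0 -> \forall y \near x, y != 0.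
Proof.
rewrite -normr_gt0 => x0.
have /= : \forall y \near x, 0 < `|y|.
  by apply: (cvgr_gt _ (@norm_continuous _ V x)).
by apply: filterS => y; rewrite normr_gt0.
Qed.

Lemma orientation_preservingP (f : V -> V) :
  orientation_preserving f <-> homotopic (fun x => f x - f 0) id.
Proof.
split=> -[H [cH H0 HF HG]].
  exists (fun p => H (clamp p.1, p.2)); split => [t x x0|t x x0|x x0|x x0].
  - move/subspace_continuousP : cH => cH.
    have Ap : (`[0%R, 1%R] `*` [set x : V | x != 0]) (clamp t, x).
      by split => //=; rewrite in_itv /= clamp_itv.
    move=> B /= nB.
    have c1 : (fun p : R * V => (clamp p.1, p.2)) @ (t, x) --> (clamp t, x).
      apply: cvg_pair_nbhs; last exact: cvg_snd.
      by apply: continuous_cvg; [exact: clamp_continuous | exact: cvg_fst].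
    have h : \forall p \near (t, x), (`[0%R, 1%R] `*` [set x : V | x != 0])
      (clamp p.1, p.2) -> B (H (clamp p.1, p.2)) := c1 _ (cH _ Ap _ nB).
    have : \forall q \near (t, x), q.2 != 0 :> V.
      have c2 : (fun q : R * V => q.2) @ (t, x) --> x by exact: cvg_snd.
      exact: (c2 _ (nonzero_near x0)).
    move=> n0; change (\forall p \near (t, x), B (H (clamp p.1, p.2))).
    apply: filterS (filterI h n0) => -[s y] /= [hB y0]; apply: hB; split => //=.
    by rewrite in_itv /= clamp_itv.
  - by apply: H0 => //; exact: clamp_itv.
  - by rewrite /= clamp_id ?HF // lexx ler01.
  - by rewrite /= clamp_id ?HG // lexx ler01.
exists H; split => // [|t x _]; last exact: H0.
apply/subspace_continuousP => -[t x] [_ /= x0].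
by apply: cvg_within_filter; exact: cH.
Qed.

Lemma homotopic_sym F G : homotopic F G -> homotopic G F.
Proof.
case=> H [cH H0 HF HG]; exists (fun p => H (1 - p.1, p.2)).
split => [t x x0|t x x0|x x0|x x0] /=.
- apply: (@continuous_comp _ _ _ (fun p : R * V => (1 - p.1, p.2)) H).
    apply: cvg_pair_nbhs; last exact: cvg_snd.
    by apply: cvgB; [exact: cvg_cst | exact: cvg_fst].
  exact: cH.
- exact: H0.
- by rewrite subr0 HG.
- by rewrite subrr HF.
Qed.

Lemma homotopic_trans G F F' :
  homotopic F G -> homotopic G F' -> homotopic F F'.
Proof.
case=> H [cH H0 HF HG] [H' [cH' H0' HF' HG']].
pose a (p : R * V) := (clamp (2 * p.1), p.2).
pose b (p : R * V) := (clamp (2 * p.1 - 1), p.2).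
have ca p : {for p, continuous a}.
  apply: cvg_pair_nbhs; last exact: cvg_snd.
  apply: continuous_cvg; first exact: clamp_continuous.
  by apply: cvgM; [exact: cvg_cst | exact: cvg_fst].
have cb p : {for p, continuous b}.
  apply: cvg_pair_nbhs; last exact: cvg_snd.
  apply: continuous_cvg; first exact: clamp_continuous.
  apply: cvgB; last exact: cvg_cst.
  by apply: cvgM; [exact: cvg_cst | exact: cvg_fst].
have cHa t x : x != 0 -> {for (t, x), continuous (H \o a)}.
  by move=> x0; apply: continuous_comp; [exact: ca | exact: cH].
have cHb t x : x != 0 -> {for (t, x), continuous (H' \o b)}.
  by move=> x0; apply: continuous_comp; [exact: cb | exact: cH'].
exists (fun p => if p.1 <= 2^-1 then (H \o a) p else (H' \o b) p).
split => [t x x0|t x x0|x x0|x x0] /=.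
- have c1 : {for (t, x), continuous (fun p : R * V => p.1)} by exact: cvg_fst.
  have [t2|t2|t2] := ltgtP t 2^-1.
  + apply: continuous_at_near (cHa t x x0).
    have h : \forall p \near (t, x), p.1 < 2^-1 := c1 _ (lt_nbhsl t2).
    by apply: filterS h => p /= /ltW ->.
  + apply: continuous_at_near (cHb t x x0).
    have h : \forall p \near (t, x), p.1 > 2^-1 := c1 _ (lt_nbhsr t2).
    by apply: filterS h => p /=; rewrite ltNge => /negbTE ->.
  + apply: (@continuous_at_paste _ _ (fun p : R * V => p.1 <= 2^-1)).
    * exact: cHa.
    * exact: cHb.
    * rewrite /= /a /b t2 /= !clamp_id; [|lra|lra].
      rewrite mulfV ?pnatr_eq0 // subrr HG //.
      by rewrite HF'.
- by case: ifP => _; [exact: H0 | exact: H0'].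
- rewrite ifT; last by rewrite invr_ge0 ler0n.
  by rewrite /a /= mulr0 clamp_id ?HF // lexx ler01.
- rewrite ifF; last by apply/negbTE; rewrite -ltNge; lra.
  rewrite /b /= (_ : 2 * 1 - 1 = 1); last by lra.
  by rewrite clamp_id ?HG' // lexx ler01.
Qed.

Lemma homotopic_precomp F G (f : V -> V) :
  continuous f -> (forall x, x != 0 -> f x != 0) ->
  homotopic F G -> homotopic (F \o f) (G \o f).
Proof.
move=> cf f0 [H [cH H0 HF HG]]; exists (fun p => H (p.1, f p.2)).
split => [t x x0|t x x0|x x0|x x0] /=.
- apply: (@continuous_comp _ _ _ (fun p : R * V => (p.1, f p.2)) H).
    apply: cvg_pair_nbhs; first exact: cvg_fst.
    by apply: continuous_cvg; [exact: cf | exact: cvg_snd].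
  by apply: cH; exact: f0.
- exact/H0/f0.
- by rewrite HF // f0.
- by rewrite HG // f0.
Qed.

(* Moving the base point c + t (d - c) linearly. *)
Lemma homotopic_base (f : V -> V) c d : continuous f -> injective f ->
  homotopic (fun x => f (c + x) - f c) (fun x => f (d + x) - f d).
Proof.
move=> cf fi; pose b (p : R * V) := c + p.1 *: (d - c).
have cb : continuous b.
  move=> p; apply: cvgD; first exact: cvg_cst.
  by apply: cvgZr_tmp; exact: cvg_fst.
exists (fun p => f (b p + p.2) - f (b p)); split => [t x x0|t x x0|x x0|x x0].
- apply: cvgB.
    apply: (continuous_cvg _ (cf _)); apply: cvgD; first exact: cb.
    exact: cvg_snd.
  by apply: (continuous_cvg _ (cf _)); exact: cb.
- apply: contraNneq x0; move/eqP; rewrite subr_eq0 => /eqP /fi.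
  by rewrite -[RHS]addr0 => /addrI /= ->.
- by rewrite /b /= scale0r addr0.
- by rewrite /b /= scale1r [c + _]addrC subrK.
Qed.

Lemma homotopic_eq F G F' G' :
  F =1 F' -> G =1 G' -> homotopic F G -> homotopic F' G'.
Proof. by move=> /funext <- /funext <-. Qed.

Lemma equivalent_sym K L : equivalent K L -> equivalent L K.
Proof.
case=> f [[g [fK gK cf cg]] /orientation_preservingP of_ <-].
exists g; split; first by exists f.
  apply/orientation_preservingP.
  pose G' x := g (f 0 + x).
  have G'0 x : x != 0 -> G' x != 0.
    apply: contra_neq => e; have : f (g (f 0 + x)) = f 0 by rewrite -/(G' x) e.
    by rewrite gK -[RHS]addr0 => /addrI.
  have cG' : continuous G'.
    have c1 : continuous (fun x : V => f 0 + x).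
      move=> x; apply: (@cvgD R V V (nbhs x)); first exact: cvg_cst.
      exact: cvg_id.
    by move=> x; exact: (continuous_comp (c1 x) (cg _)).
  apply: (@homotopic_trans G').
    have := @homotopic_base g 0 (f 0) cg (can_inj gK).
    by apply: homotopic_eq => x; rewrite ?add0r // /G' fK subr0.
  apply: homotopic_sym.
  apply: homotopic_eq (homotopic_precomp cG' G'0 of_) => //.
  by move=> x /=; rewrite /G' gK addrC addKr.
apply/seteqP; split=> [x /= [_ [y Ky <-] <-]|x Kx]; first by rewrite fK.
by exists (f x); [exists x | rewrite fK].
Qed.

Lemma equivalent_trans L K K' :
  equivalent K L -> equivalent L K' -> equivalent K K'.
Proof.
case=> f [[g [fK gK cf cg]] /orientation_preservingP of_ <-].
case=> f' [[g' [fK' gK' cf' cg']] /orientation_preservingP of' <-].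
exists (f' \o f); split; last by rewrite image_comp.
  exists (g \o g'); split.
  - exact: can_comp.
  - exact: can_comp.
  - by move=> x; apply: continuous_comp; [exact: cf | exact: cf'].
  - by move=> x; apply: continuous_comp; [exact: cg' | exact: cg].
apply/orientation_preservingP.
pose F x := f x - f 0.
have F0 x : x != 0 -> F x != 0.
  apply: contra_neq => /eqP; rewrite subr_eq0 => /eqP /(can_inj fK).
  by [].
have cF : continuous F.
  by move=> x; apply: (@cvgB R V V (nbhs x)); [exact: cf | exact: cvg_cst].
apply: (@homotopic_trans F) => //.
have h1 := homotopic_base (f 0) 0 cf' (can_inj fK').
have h2 : homotopic (fun x => f' (f 0 + x) - f' (f 0)) id.
  by apply: (homotopic_trans h1); apply: homotopic_eq of' => x; rewrite ?add0r.
apply: homotopic_eq (homotopic_precomp cF F0 h2) => x //=.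
by rewrite /F [f 0 + _]addrC subrK.
Qed.

End Homotopy.

Section Mirror.
Variable R : realType.
Notation V := (space3 R).
Implicit Types (K L : set V).

Lemma vec3E (x : V) : vec3 (x 0 0) (x 0 1) (x 0 2%R) = x.
Proof.
by apply/rowP => -[[|[|[|//]]] i]; rewrite mxE /=; congr (x _ _); exact/val_inj.
Qed.

Lemma vec3_inj (a b c a' b' c' : R) :
  vec3 a b c = vec3 a' b' c' -> [/\ a = a', b = b' & c = c'].
Proof.
by move=> /rowP e; move: (e 0) (e 1) (e 2%R); rewrite !mxE.
Qed.

Lemma cvg_vec3 (T : Type) (F : set_system T) (FF : Filter F) (f g h : T -> R)
    (a b c : R) : f @ F --> a -> g @ F --> b -> h @ F --> c ->
  (fun x => vec3 (f x) (g x) (h x)) @ F --> vec3 a b c.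
Proof.
have vE (u v w : R) :
    vec3 u v w = u *: vec3 1 0 0 + v *: vec3 0 1 0 + w *: vec3 0 0 1.
  by apply/rowP => -[[|[|[|//]]] i]; rewrite !mxE /=; ring.
move=> fa gb hc; rewrite vE; under eq_fun do rewrite vE.
by apply: cvgD; [apply: cvgD|]; exact: cvgZr_tmp.
Qed.

Lemma vec3B (a b c a' b' c' : R) :
  vec3 a b c - vec3 a' b' c' = vec3 (a - a') (b - b') (c - c').
Proof. by apply/rowP => -[[|[|[|//]]] i]; rewrite !mxE. Qed.

Lemma reflectionK : involutive (@reflection R).
Proof. by move=> x; rewrite /reflection !mxE /= opprK vec3E. Qed.

Lemma reflectionB (x y : V) : reflection (x - y) = reflection x - reflection y.
Proof. by rewrite /reflection vec3B !mxE opprD. Qed.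

Lemma reflection0 : reflection 0 = 0 :> V.
Proof.
by rewrite (_ : (0 : V) = 0 - 0) ?reflectionB ?subrr.
Qed.

Lemma reflection_neq0 (x : V) : x != 0 -> reflection x != 0.
Proof.
by apply: contra_neq => x0; rewrite -[x]reflectionK x0 reflection0.
Qed.

Lemma coord3_continuous j : continuous (fun x : V => x 0 j).
Proof. exact: coord_continuous. Qed.

Lemma reflection_continuous : continuous (@reflection R).
Proof.
move=> x; apply: (@cvg_vec3 _ (nbhs x)).
- exact: coord3_continuous.
- exact: coord3_continuous.
- by apply: cvgN; exact: coord3_continuous.
Qed.

Lemma equivalent_mirror K L :
  equivalent K L -> equivalent (mirror K) (mirror L).
Proof.
have cr := reflection_continuous.
case=> f [[g [fK gK cf cg]] /orientation_preservingP [H [cH H0 HF HG]] <-].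
pose conj (h : V -> V) x := reflection (h (reflection x)).
have cc (h : V -> V) : continuous h -> continuous (conj h).
  move=> ch x.
  exact: (continuous_comp (continuous_comp (cr x) (ch _)) (cr _)).
exists (conj f); split.
- exists (conj g); split; [| |exact: cc|exact: cc].
    by move=> x; rewrite /conj reflectionK fK reflectionK.
  by move=> x; rewrite /conj reflectionK gK reflectionK.
- apply/orientation_preservingP.
  exists (fun p => reflection (H (p.1, reflection p.2))).
  split => [t x x0|t x x0|x x0|x x0] /=.
  + pose b (p : R * V) := (p.1, reflection p.2).
    have cb : {for (t, x), continuous b}.
      apply: cvg_pair_nbhs; first exact: cvg_fst.
      have c2 : (fun q : R * V => q.2) @ (t, x) --> x by exact: cvg_snd.
      by apply: (continuous_cvg _ (cr _)).
    have cHb : {for (t, x), continuous (H \o b)}.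
      by apply: (continuous_comp cb); apply: cH; exact: reflection_neq0.
    exact: (continuous_comp cHb (cr _)).
  + by apply: reflection_neq0; apply: H0; exact: reflection_neq0.
  + by rewrite HF ?reflection_neq0 // reflectionB /conj reflection0.
  + by rewrite HG ?reflection_neq0 // reflectionK.
- apply/seteqP; split=> [_ [_ [x Kx <-] <-]|_ [_ [x Kx <-] <-]].
    by rewrite /conj reflectionK; exists (f x) => //; exists x.
  by exists (reflection x); [exists x | rewrite /conj reflectionK].
Qed.

Lemma equivalent_antipode_mirror L : equivalent (@antipode R @` L) (mirror L).
Proof.
pose f (x : V) := reflection (- x).
have fE x : f x = vec3 (- x 0 0) (- x 0 1) (x 0 2%R).
  by rewrite /f /reflection !mxE opprK.
have fK : involutive f by move=> x; rewrite !fE !mxE /= !opprK vec3E.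
have cf : continuous f.
  move=> x; rewrite (_ : f = fun x => vec3 (- x 0 0) (- x 0 1) (x 0 2%R)).
    apply: (@cvg_vec3 _ (nbhs x)); [| |exact: coord3_continuous];
      apply: cvgN; exact: coord3_continuous.
  exact/funext.
exists f; split.
- by exists f.
- apply/orientation_preservingP.
  (* Along (c, s) = (2t - 1, t (1 - t)), which joins (-1, 0) to (1, 0) in the
     punctured plane, the map x + iy |-> (c + is)(x + iy) is invertible. *)
  pose c (t : R) := 2 * t - 1; pose s (t : R) := t * (1 - t).
  have cs t : 0 < c t ^+ 2 + s t ^+ 2.
    rewrite lt0r addr_ge0 ?sqr_ge0 // andbT paddr_eq0 ?sqr_ge0 // !sqrf_eq0.
    apply/negP => /andP[/eqP c0 /eqP s0]; move: c0 s0; rewrite /c /s => c0.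
    rewrite (_ : t = 2^-1); first by apply/eqP; rewrite mulf_neq0 //; lra.
    lra.
  exists (fun p : R * V => vec3 (c p.1 * p.2 0 0 - s p.1 * p.2 0 1)
                        (s p.1 * p.2 0 0 + c p.1 * p.2 0 1) (p.2 0 2%R)).
  split => [t x x0|t x x0|x x0|x x0] /=.
  + have c1 : (fun p : R * V => p.1) @ (t, x) --> t by exact: cvg_fst.
    have c2 j : (fun p : R * V => p.2 0 j) @ (t, x) --> x 0 j.
      have c2 : (fun q : R * V => q.2) @ (t, x) --> x by exact: cvg_snd.
      exact: (cvg_comp _ _ c2 (@coord3_continuous j x)).
    have cc : (fun p : R * V => c p.1) @ (t, x) --> c t.
      apply: cvgB; last exact: cvg_cst.
      by apply: cvgM; [exact: cvg_cst|exact: c1].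
    have c_s : (fun p : R * V => s p.1) @ (t, x) --> s t.
      by apply: cvgM; [exact: c1|apply: cvgB; [exact: cvg_cst|exact: c1]].
    apply: cvg_vec3; last exact: c2.
      by apply: cvgB; apply: cvgM => //; exact: c2.
    by apply: cvgD; apply: cvgM => //; exact: c2.
  + apply: contra_neq x0 => e.
    have /vec3_inj[e0 e1 e2] : vec3 (c t * x 0 0 - s t * x 0 1)
        (s t * x 0 0 + c t * x 0 1) (x 0 2%R) = vec3 0 0 0 :> V.
      by rewrite e; apply/rowP => -[[|[|[|//]]] i]; rewrite !mxE.
    have z (y : R) : (c t ^+ 2 + s t ^+ 2) * y = 0 -> y = 0.
      by move=> /eqP; rewrite mulf_eq0 gt_eqF //= => /eqP.
    have x00 : x 0 0 = 0.
      apply: z; rewrite (_ : _ * _ = c t * (c t * x 0 0 - s t * x 0 1) +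
        s t * (s t * x 0 0 + c t * x 0 1)); last by ring.
      by rewrite e0 e1 !mulr0 addr0.
    have x01 : x 0 1 = 0.
      apply: z; rewrite (_ : _ * _ = c t * (s t * x 0 0 + c t * x 0 1) -
        s t * (c t * x 0 0 - s t * x 0 1)); last by ring.
      by rewrite e0 e1 !mulr0 subr0.
    rewrite -(vec3E x) x00 x01 e2.
    by apply/rowP => -[[|[|[|//]]] i]; rewrite !mxE.
  + rewrite !fE vec3B !mxE /c /s; congr vec3; ring.
  + rewrite -[RHS]vec3E /c /s; congr vec3; ring.
- rewrite image_comp; congr image; apply/funext => x.
  by rewrite /= /f /antipode opprK.
Qed.

End Mirror.

(** * Radial homeomorphisms *)

Section Radial.
Variable R : realType.
Notation V := (space3 R).
Implicit Types (x y : V) (d : V * R -> R).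

Definition enorm x : R := Num.sqrt (\sum_j x 0 j ^+ 2).

Lemma enorm_continuous : continuous enorm.
Proof.
move=> x; apply: (@cvg_comp _ _ _ (fun x : V => \sum_j x 0 j ^+ 2) (@Num.sqrt R)
  (nbhs x)); last exact: sqrt_continuous.
apply: (@cvg_bigsum R _ (nbhs x)) => j.
exact: (cvg_comp _ _ (@coord3_continuous R j x) (@exprn_continuous R 2 _)).
Qed.

Lemma enormZ a x : enorm (a *: x) = `|a| * enorm x.
Proof.
rewrite /enorm -sqrtr_sqr -sqrtrM ?sqr_ge0 //; congr Num.sqrt.
by rewrite mulr_sumr; apply: eq_bigr => j _; rewrite mxE exprMn.
Qed.

Lemma enorm_ge0 x : 0 <= enorm x. Proof. exact: sqrtr_ge0. Qed.


Lemma enorm_gt0 x : x != 0 -> 0 < enorm x.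
Proof.
have sq0 (j : 'I_3) : true -> 0 <= x 0 j ^+ 2 by move=> _; exact: sqr_ge0.
move=> x0; rewrite sqrtr_gt0 lt0r sumr_ge0 // andbT.
apply: contra_neq x0 => /eqP; rewrite psumr_eq0 // => /allP e.
apply/rowP => j; rewrite mxE; apply/eqP; rewrite -sqrf_eq0.
by apply: e; rewrite mem_index_enum.
Qed.

Lemma enorm_sphere x : sphere x <-> enorm x = 1.
Proof.
split=> [e|e]; first by rewrite /enorm e sqrtr1.
rewrite /sphere /= -[LHS]sqr_sqrtr ?sumr_ge0 -/(enorm x) ?e ?expr1n //.
by move=> j _; exact: sqr_ge0.
Qed.

(* In logarithmic scale: on the ray through the unit vector x, the point at
   distance e^s from the origin goes to the one at distance e^(s + d (x, s)). *)
Definition radial d y : V :=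
  expR (d ((enorm y)^-1 *: y, ln (enorm y))) *: y.

Lemma radial_sphere d x r : sphere x -> 0 < r ->
  radial d (r *: x) = expR (ln r + d (x, ln r)) *: x.
Proof.
move=> /enorm_sphere ex r0; rewrite /radial enormZ ex mulr1 gtr0_norm //.
rewrite !scalerA mulVf ?gt_eqF // scale1r addrC expRD lnK ?posrE //.
Qed.

Lemma radial_comp d d' : (forall x s, d' (x, s + d (x, s)) = - d (x, s)) ->
  cancel (radial d) (radial d').
Proof.
move=> dK y; have [->|y0] := eqVneq y 0; first by rewrite /radial !scaler0.
have ey := enorm_gt0 y0; set x := (enorm y)^-1 *: y.
have sx : sphere x.
  by apply/enorm_sphere; rewrite enormZ gtr0_norm ?invr_gt0 // mulVf ?gt_eqF.
have yE : y = enorm y *: x by rewrite scalerA divff ?scale1r // gt_eqF.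
rewrite {1}yE (radial_sphere d sx ey) (radial_sphere d' sx (expR_gt0 _)).
by rewrite expRK dK addrK lnK // -yE.
Qed.

Lemma radial_continuous d C : continuous d -> (forall p, `|d p| <= C) ->
  continuous (radial d).
Proof.
move=> cd dC y; have [->|y0] := eqVneq y 0.
  rewrite /prop_for /continuous_at {2}/radial scaler0.
  apply/(@norm_cvg0P _ _ _ (nbhs (0 : V))).
  apply: (@squeeze_cvgr _ (nbhs (0 : V)) _ R (fun=> 0)
    (fun y => expR C * `|y|)).
  - near=> z; rewrite normr_ge0 /= normrZ ger0_norm ?expR_ge0 //.
    apply: ler_wpM2r => //; rewrite ler_expR.
    by apply: le_trans (dC _); exact: ler_norm.
  - exact: cvg_cst.
  - rewrite -[X in _ --> X](mulr0 (expR C)); apply: cvgM; first exact: cvg_cst.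
    rewrite -[X in _ --> X](@normr0 _ V).
    exact: norm_continuous.
have ey := enorm_gt0 y0; have ce : enorm x @[x --> y] --> enorm y.
  exact: enorm_continuous.
apply: (@cvgZ R V V (nbhs y)); last exact: cvg_id.
apply: (@cvg_app _ _ _ (nbhs y) _ _ _ _ (@continuous_expR R _)).
apply: (@cvg_app _ _ _ (nbhs y) _ _ _ _ (cd _)).
apply: cvg_pair_nbhs; last exact: (cvg_comp _ _ ce (continuous_ln ey)).
apply: (@cvgZ R V V (nbhs y)); last exact: cvg_id.
by apply: (@cvgV R V (nbhs y)) => //; rewrite gt_eqF.
Unshelve. all: by end_near. Qed.

Lemma radial_orientation d : continuous (radial d) ->
  orientation_preserving (radial d).
Proof.
move=> cr; apply/orientation_preservingP.
pose a (p : R * V) := clamp p.1 + (1 - clamp p.1) * expR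
   (d ((enorm p.2)^-1 *: p.2, ln (enorm p.2))).
exists (fun p : R * V => clamp p.1 *: p.2 + (1 - clamp p.1) *: radial d p.2).
split => [t x x0|t x x0|x x0|x x0] /=.
- have c1 : (fun p : R * V => clamp p.1) @ (t, x) --> clamp t.
    have c1 : (fun p : R * V => p.1) @ (t, x) --> t by exact: cvg_fst.
    exact: (cvg_comp _ _ c1 (@clamp_continuous R t)).
  have c2 : (fun p : R * V => p.2) @ (t, x) --> x by exact: cvg_snd.
  apply: cvgD; apply: cvgZ => //; last exact: (cvg_comp _ _ c2 (cr x)).
  by apply: cvgB => //; exact: cvg_cst.
- rewrite scalerA -scalerDl scaler_eq0 negb_or x0 andbT.
  have /andP[c0 c1] := clamp_itv t; set e := expR _.
  have e0 : 0 < e by exact: expR_gt0.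
  apply: lt0r_neq0; have [->|] := eqVneq (clamp t) 0.
    by rewrite add0r subr0 mul1r.
  rewrite neq_lt ltNge c0 /= => c_gt0; apply: ltr_pwDl => //.
  by rewrite mulr_ge0 ?subr_ge0 // ltW.
- rewrite clamp_id ?lexx ?ler01 // scale0r add0r subr0 scale1r.
  by rewrite [radial d 0]/radial scaler0 subr0.
- by rewrite clamp_id ?lexx ?ler01 // subrr scale0r addr0 scale1r.
Qed.

Definition shift_family d :=
  [/\ continuous d, exists C, forall p, `|d p| <= C &
      forall x s s', s < s' -> s + d (x, s) < s' + d (x, s')].

Lemma shift_family_inv d : shift_family d -> exists d',
  [/\ continuous d', exists C, forall p, `|d' p| <= C,
      forall x s, d' (x, s + d (x, s)) = - d (x, s) &
      forall x s, d (x, s + d' (x, s)) = - d' (x, s)].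
Proof.
case=> cd [C dC] di.
have mono x s s' : (s + d (x, s) < s' + d (x, s')) = (s < s').
  apply: (@leW_mono _ _ R R (fun s => s + d (x, s))).
  by apply: le_mono => a b; exact: di.
have surj x s : exists r, r + d (x, r) = s.
  have dr r : -C <= d (x, r) <= C by rewrite -ler_norml.
  have C0 : 0 <= C by apply: le_trans (dC (x, 0)).
  have [r _ rE] : exists2 r, r \in `[s - C, s + C] & r + d (x, r) = s.
    apply: IVT.
    - by rewrite lerD2l; lra.
    - apply: continuous_subspaceT => r; apply: (@cvgD R R R (nbhs r)).
        exact: cvg_id.
      apply: (@cvg_app _ _ _ (nbhs r) _ _ _ _ (cd (x, r))).
      by apply: cvg_pair_nbhs; [exact: cvg_cst | exact: cvg_id].
    - have := dr (s - C); have := dr (s + C) => h1 h2.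
      by rewrite ge_min le_max; apply/andP; split; apply/orP;
        [left|right]; lra.
  by exists r.
pose r x s := projT1 (cid (surj x s)).
have rE x s : r x s + d (x, r x s) = s := projT2 (cid (surj x s)).
have ri x a s : (a < r x s) = (a + d (x, a) < s).
  by rewrite -[in RHS](rE x s) mono.
have ri' x a s : (r x s < a) = (s < a + d (x, a)).
  by rewrite -[in RHS](rE x s) mono.
have rK x s : r x (s + d (x, s)) = s.
  by apply/eqP; rewrite eq_le !leNgt ri ri' ltxx.
have cr : continuous (fun p : V * R => r p.1 p.2).
  move=> [x s]; apply/cvgrPdist_lt => e e0.
  have ca a : (fun p : V * R => a + d (p.1, a)) @ (x, s) --> a + d (x, a).
    apply: cvgD; first exact: cvg_cst.
    apply: (@cvg_app _ _ _ (nbhs (x, s)) _ _ _ _ (cd (x, a))).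
    by apply: cvg_pair_nbhs; [exact: cvg_fst | exact: cvg_cst].
  have cs : (fun p : V * R => p.2) @ (x, s) --> s by exact: cvg_snd.
  have gap a b : a + d (x, a) < s < b + d (x, b) ->
    \forall p \near (x, s), a < r p.1 p.2 < b.
    case/andP => ha hb.
    have na : \forall p \near (x, s), 0 < p.2 - (a + d (p.1, a)).
      by apply: (cvgr_gt _ (cvgB cs (ca a))); rewrite subr_gt0.
    have nb : \forall p \near (x, s), 0 < b + d (p.1, b) - p.2.
      by apply: (cvgr_gt _ (cvgB (ca b) cs)); rewrite subr_gt0.
    apply: filterS (filterI na nb) => p [].
    by rewrite !subr_gt0 -ri -ri' => -> ->.
  have : (r x s - e) + d (x, r x s - e) < s < (r x s + e) + d (x, r x s + e).
    by rewrite -ri -ri' gtrBl ltrDl e0.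
  move=> /gap; apply: filterS => p /=; rewrite ltr_norml; lra.
exists (fun p => r p.1 p.2 - p.2); split => [p||x s|x s] /=.
- apply: (@cvgB _ _ _ (nbhs p)); first exact: cr.
  by case: p => x s; exact: cvg_snd.
- exists C => -[x s] /=; rewrite (_ : _ - _ = - d (x, r x s)) ?normrN //.
  by have := rE x s; lra.
- by rewrite rK opprD addNKr.
- by rewrite [s + _]addrC subrK; have := rE x s; lra.
Qed.

Lemma radial_equivalent d (K : set V) : shift_family d ->
  equivalent K (radial d @` K).
Proof.
move=> sd; have [d' [cd' [C' dC'] dK dK']] := shift_family_inv sd.
case: sd => cd [C dC] _; have cr := radial_continuous cd dC.
exists (radial d); split => //; last exact: radial_orientation.
exists (radial d'); split => //; [exact: radial_comp|exact: radial_comp|].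
exact: (radial_continuous cd' dC').
Qed.

End Radial.

(** * Interpolation of heights *)

Section Interpolation.
Variable R : realType.
Notation V := (space3 R).

Lemma closed_weight (A : set V) : closed A -> exists w : V -> R,
  [/\ continuous w, forall x, 0 <= w x & forall x, 0 < w x <-> ~ A x].
Proof.
move=> cA; have [[a0 Aa0]|A0] := pselect (A !=set0); last first.
  exists (fun=> 1); split => [||x]; [exact: cst_continuous|by []|].
  by split=> // _ Ax; apply: A0; exists x.
pose S x := [set `|x - a| | a in A].
have lbS x : lbound (S x) 0 by move=> _ [a _ <-]; exact: normr_ge0.
have S0 x : (S x) !=set0 by exists `|x - a0|, a0.
have infS x a : A a -> inf (S x) <= `|x - a|.
  by move=> Aa; apply: ge_inf; [exists 0; exact: lbS | exists a].
have lip x y : inf (S x) - inf (S y) <= `|x - y|.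
  rewrite lerBlDr -lerBlDl; apply: lb_le_inf => // _ [a Aa <-].
  rewrite lerBlDl; apply: le_trans (infS x a Aa) _.
  by rewrite (_ : x - a = (x - y) + (y - a)) ?ler_normD // addrA subrK.
exists (fun x => inf (S x)); split => [x|x|x].
- apply/(@cvgrPdist_lt _ _ _ (nbhs x)) => e e0.
  have : nbhs x (ball x e) by exact: nbhsx_ballx.
  rewrite -ball_normE.
  apply: filterS => y xy; apply: le_lt_trans xy.
  by rewrite ler_norml lip andbT lerNl opprB distrC lip.
- exact: lb_le_inf.
- split=> [w0 Ax|Ax].
    by have := infS x x Ax; rewrite subrr normr0 leNgt w0.
  have : nbhs x (~` A) by apply: open_nbhs_nbhs; split => //;
    exact: closed_openC.
  rewrite -nbhs_ballE => -[e /= e0 eA]; apply: (lt_le_trans e0).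
  apply: lb_le_inf => // _ [a Aa <-]; rewrite leNgt; apply/negP => xa.
  by apply: (eA a) => //; rewrite -ball_normE.
Qed.

Lemma extend_pieces (I : finType) (P : pred I) (A : I -> set V)
    (f : I -> V -> R) :
  (forall i, compact (A i)) -> (forall i, {within A i, continuous (f i)}) ->
  (forall i j x, P i -> P j -> A i x -> A j x -> f i x = f j x) ->
  exists g : V -> R, [/\ continuous g, exists C, forall x, `|g x| <= C &
    forall i x, P i -> A i x -> g x = f i x].
Proof.
move=> kA cf fE.
have cA i : closed (A i) by apply: compact_closed => //; exact: norm_hausdorff.
have /choice[C fC] i : exists C, forall x, A i x -> `|f i x| <= C.
  have [M [_ MB]] := compact_bounded (continuous_compact (cf i) (kA i)).
  exists (M + 1) => x Ax; apply: (MB (M + 1)); first by rewrite ltrDl.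
  by exists x.
pose B := \bigcup_(i in [set i | P i]) A i.
have cB : closed B by apply: closed_bigcup => //; exact: finite_finset.
pose F x := if [pick i | P i && `[< A i x >]] is Some i then f i x else 0.
have FE i x : P i -> A i x -> F x = f i x.
  move=> Pi Ax; rewrite /F; case: pickP => [j /andP[Pj /asboolP Aj]|/(_ i)].
    exact: fE.
  by rewrite Pi /= => /asboolP.
have cF : {within B, continuous F}.
  apply/subspace_continuousP => x [i0 Pi0 Ai0] U nU.
  have h i : \forall y \near x, P i -> A i y -> U (f i y).
    have [Pi|Pi] := boolP (P i); last by near=> y.
    have [Ax|Ax] := pselect (A i x); last first.
      have : nbhs x (~` A i).
        by apply: open_nbhs_nbhs; split => //; exact: closed_openC.
      by apply: filterS => y nA _ /nA.
    have /subspace_continuousP/(_ x Ax) cfx := cf i.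
    have nU' : nbhs (f i x) U by rewrite -(FE i x Pi Ax).
    have h1 : \forall y \near x, A i y -> U (f i y) := cfx U nU'.
    by apply: filterS h1 => y hy _.
  have hI : \forall y \near x, forall i, P i -> A i y -> U (f i y).
    exact: (@filter_forall _ _ _ (nbhs x) _ h).
  have hB : \forall y \near x, B y -> U (F y).
    by apply: filterS hI => y hy [i Pi Ai]; rewrite (FE i) //; exact: hy.
  exact: hB.
pose M := 1 + \sum_i `|C i|.
have M0 : 0 < M by rewrite ltr_pwDl // sumr_ge0.
have FM x : B x -> `|F x| <= M.
  move=> [i Pi Ai]; rewrite (FE i) //; apply: le_trans (fC i _ Ai) _.
  apply: le_trans (ler_norm _) _; rewrite /M (bigD1 i) //= addrCA lerDl.
  by rewrite addr_ge0 // sumr_ge0.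
have [g [Fg cg gM]] := continuous_bounded_extension pseudometric_normal cB M0
  cF FM.
exists g; split => //; first by exists M.
by move=> i x Pi Ax; rewrite -Fg ?(FE i) // inE; exists i.
Unshelve. all: by end_near. Qed.

Lemma shift_family_fst (g : V -> R) C : continuous g ->
  (forall x, `|g x| <= C) ->
  shift_family (fun p => g p.1).
Proof.
move=> cg gC; split; last by move=> x s s' ss /=; rewrite ltrD2r.
  move=> [x s]; apply: (@cvg_app _ _ _ (nbhs (x, s)) _ _ _ _ (cg x)).
  exact: cvg_fst.
by exists C => p.
Qed.

Lemma shift_family_glue (I : finType) (w : I -> V -> R) (d : I -> V * R -> R) :
  (forall i, continuous (w i)) -> (forall i x, 0 <= w i x) ->
  (forall x, exists i, 0 < w i x) -> (forall i, shift_family (d i)) ->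
  exists2 d0, shift_family d0 &
    forall x s t, (forall i, 0 < w i x -> d i (x, s) = t) -> d0 (x, s) = t.
Proof.
move=> cw w0 wpos sd.
pose W x := \sum_i w i x.
have W0 x : 0 < W x.
  by have [i wi] := wpos x; rewrite /W (bigD1 i) //= ltr_pwDl // sumr_ge0.
pose d0 p := (\sum_i w i p.1 * d i p) / W p.1.
have fst_x (x : V) (s : R) : (fun p : V * R => p.1) @ (x, s) --> x.
  exact: cvg_fst.
have d0E x s r : r + d0 (x, s) = (\sum_i w i x * (r + d i (x, s))) / W x.
  rewrite /d0 /=; under [in RHS]eq_bigr do rewrite mulrDr.
  rewrite big_split /= -mulr_suml -/(W x) mulrDl mulrAC divff ?mul1r //.
  by rewrite gt_eqF.
exists d0; [split|].
- move=> [x s].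
  have cwx i : (fun p : V * R => w i p.1) @ (x, s) --> w i x.
    exact: (cvg_app _ (cw i x) (fst_x x s)).
  apply: cvgM.
    apply: (@cvg_bigsum R _ (nbhs (x, s))) => i; apply: cvgM.
      exact: cwx.
    by case: (sd i) => + _ _; apply.
  apply: cvgV; first by rewrite gt_eqF.
  apply: (@cvg_bigsum R _ (nbhs (x, s))) => i.
  exact: cwx.
- have /choice[C dC] i : exists C, forall p, `|d i p| <= C by case: (sd i).
  exists (\sum_i `|C i|) => -[x s];
    rewrite /d0 normrM normfV (gtr0_norm (W0 x)) /=.
  rewrite ler_pdivrMr // /W mulr_sumr; apply: le_trans (ler_norm_sum _ _ _) _.
  apply: ler_sum => i _; rewrite normrM (ger0_norm (w0 i x)) mulrC ler_wpM2r //.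
  apply: le_trans (dC i _) _; apply: le_trans (ler_norm _) _.
  by rewrite (bigD1 i) //= lerDl sumr_ge0.
- move=> x s s' ss; rewrite !d0E ltr_pM2r ?invr_gt0 //.
  have [i wi] := wpos x.
  have lt_i j : s + d j (x, s) < s' + d j (x, s') by case: (sd j) => _ _; apply.
  rewrite (bigD1 i) //= [ltRHS](bigD1 i) //=; apply: ltr_leD.
    by rewrite ltr_pM2l.
  by apply: ler_sum => j _; rewrite ler_wpM2l // ltW.
- move=> x s t e; rewrite /d0 /= (eq_bigr (fun i => w i x * t)) => [|i _].
    by rewrite -mulr_suml -/(W x) mulrAC divff ?mul1r // gt_eqF.
  have := w0 i x; rewrite le_eqVlt => /predU1P[<-|/e -> //].
  by rewrite !mul0r.
Qed.

(* The witness is piecewise linear in s, with slope 1 below lo and above hi; the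
   truncation D of hi - lo makes it continuous where hi - lo degenerates. *)
Lemma shift_family_two (lo hi lo' hi' : V -> R) C e : 0 < e ->
  [/\ continuous lo, continuous hi, continuous lo' & continuous hi'] ->
  (forall x, [/\ `|lo x| <= C, `|hi x| <= C, `|lo' x| <= C & `|hi' x| <= C]) ->
  exists2 d, shift_family d & forall x, lo x + e <= hi x ->
    lo' x + e <= hi' x ->
    d (x, lo x) = lo' x - lo x /\ d (x, hi x) = hi' x - hi x.
Proof.
move=> e0 [clo chi clo' chi'] bC.
pose D x := Num.max (hi x - lo x) e; pose D' x := Num.max (hi' x - lo' x) e.
have De x : e <= D x by rewrite le_max lexx orbT.
have D'e x : e <= D' x by rewrite le_max lexx orbT.
have D0 x : 0 < D x by apply: lt_le_trans (De x).
have D'0 x : 0 < D' x by apply: lt_le_trans (D'e x).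
pose c (p : V * R) := Num.max 0 (Num.min (p.2 - lo p.1) (D p.1)).
pose d (p : V * R) := lo' p.1 - lo p.1 + (D' p.1 / D p.1 - 1) * c p.
have c_ge0 p : 0 <= c p by rewrite le_max lexx.
have c_le p : c p <= D p.1 by rewrite ge_max ltW //= ge_min lexx orbT.
have cc x s s' : s <= s' -> 0 <= c (x, s') - c (x, s) <= s' - s.
  move=> ss; rewrite /c /=; have Dx := D0 x.
  case: (leP (s - lo x) (D x)) => h1; case: (leP (s' - lo x) (D x)) => h2;
    case: (leP 0 (s - lo x)) => h3; case: (leP 0 (s' - lo x)) => h4;
    case: (leP 0 (D x)) => h5; lra.
exists d; [split|].
- move=> [x s].
  have c1 (g : V -> R) : continuous g ->
      (fun p : V * R => g p.1) @ (x, s) --> g x.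
    move=> cg; apply: (@cvg_app _ _ _ (nbhs (x, s)) _ _ _ _ (cg x)).
    exact: cvg_fst.
  have c2 : (fun p : V * R => p.2) @ (x, s) --> s by exact: cvg_snd.
  have cD : (fun p : V * R => D p.1) @ (x, s) --> D x.
    apply: cvg_max; last exact: cvg_cst.
    by apply: cvgB; exact: c1.
  have cD' : (fun p : V * R => D' p.1) @ (x, s) --> D' x.
    apply: cvg_max; last exact: cvg_cst.
    by apply: cvgB; exact: c1.
  apply: cvgD; first by apply: cvgB; exact: c1.
  apply: cvgM.
    apply: cvgB; last exact: cvg_cst.
    by apply: cvgM => //; apply: cvgV => //; rewrite gt_eqF.
  apply: cvg_max; first exact: cvg_cst.
  by apply: cvg_min => //; apply: cvgB => //; exact: c1.
- exists (2 * C + (2 * C + e + (2 * C + e))) => -[x s]; rewrite /d /=.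
  have [lC hC lC' hC'] := bC x.
  have DC : D x <= 2 * C + e.
    rewrite ge_max; apply/andP; split; move: lC hC; rewrite !ler_norml; lra.
  have D'C : D' x <= 2 * C + e.
    rewrite ge_max; apply/andP; split; move: lC hC lC' hC';
      rewrite !ler_norml; lra.
  apply: le_trans (ler_normD _ _) _; apply: lerD.
    by apply: le_trans (ler_normB _ _) _; lra.
  have q0 : 0 <= c (x, s) / D x by rewrite divr_ge0 // ltW.
  have q1 : c (x, s) / D x <= 1 by rewrite ler_pdivrMr ?mul1r // c_le.
  rewrite (_ : (_ - 1) * _ = c (x, s) / D x * (D' x - D x)); last first.
    by field; rewrite gt_eqF.
  rewrite normrM ger0_norm // -[leRHS]mul1r; apply: ler_pM => //.
  apply: le_trans (ler_normB _ _) _; rewrite !gtr0_norm //; lra.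
- move=> x s s' ss; rewrite /d /=; have /andP[] := cc x _ _ (ltW ss).
  set a := c (x, s); set a' := c (x, s') => h1 h2.
  have r0 : 0 < D' x / D x by rewrite divr_gt0.
  rewrite -subr_gt0 (_ : _ - _ = (s' - s - (a' - a)) + D' x / D x * (a' - a));
    last by ring.
  have [->|] := eqVneq (a' - a) 0; first by rewrite mulr0; lra.
  rewrite neq_lt ltNge h1 /= => h3.
  by apply: ltr_wpDl; [lra | rewrite mulr_gt0].
- move=> x h h'; rewrite /d /c /=.
  have -> : D x = hi x - lo x by apply/max_idPl; lra.
  have -> : D' x = hi' x - lo' x by apply/max_idPl; lra.
  have h0 : 0 <= hi x - lo x by lra.
  split; first by rewrite subrr (min_idPl h0) maxxx mulr0 addr0.
  by rewrite minxx (max_idPr h0); field; lra.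
Qed.

End Interpolation.

Section Arcs.
Variables (R : realType) (D E : finType).
Notation V := (space3 R).
Implicit Types (A : D -> set V) (src tgt : D -> E) (pt : E -> V).

Record arc_system A src tgt pt : Prop := ArcSystem {
  arc_compact : forall d, compact (A d);
  arc_pt_inj : injective pt;
  arc_src : forall d, A d (pt (src d));
  arc_tgt : forall d, A d (pt (tgt d));
  arc_src_neq_tgt : forall d, src d != tgt d;
  arc_src_surj : forall e, exists d, src d = e;
  arc_tgt_surj : forall e, exists d, tgt d = e;
  arc_meet : forall d d' x, d != d' -> A d x -> A d' x -> exists e,
    [/\ x = pt e, (e == src d) || (e == tgt d) & (e == src d') || (e == tgt d')]
}.

(* At a crossing e, the arcs starting at e form one strand, of height T e true,
   and the arcs ending at e form the other one, of height T e false. *)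
Record arc_heights A src tgt pt (k : D -> V -> R) (T : E -> bool -> R) : Prop :=
  ArcHeights {
  height_cont : forall d, {within A d, continuous (k d)};
  height_src : forall d, k d (pt (src d)) = T (src d) true;
  height_tgt : forall d, k d (pt (tgt d)) = T (tgt d) false
}.

Definition strand src tgt (b : bool) : D -> E := if b then src else tgt.

Lemma strand_extend A src tgt pt k T e b :
  arc_system A src tgt pt -> arc_heights A src tgt pt k T ->
  exists g : V -> R, [/\ continuous g, exists C, forall x, `|g x| <= C &
    forall d x, strand src tgt b d = e -> A d x -> g x = k d x].
Proof.
move=> sA hk.
have [||d d' x /eqP de /eqP de' dx dx'|g [cg bg gE]] := @extend_pieces R D
    (fun d => strand src tgt b d == e) A k.
- exact: arc_compact sA.
- exact: height_cont hk.
- have [->//|dd] := eqVneq d d'.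
  have [e' [-> ed ed']] := arc_meet sA dd dx dx'.
  have st := arc_src_neq_tgt sA; have kS := height_src hk;
    have kT := height_tgt hk.
  have eS d0 : e' == src d0 -> k d0 (pt e') = T e' true.
    by move=> /eqP ->; exact: kS.
  have eT d0 : e' == tgt d0 -> k d0 (pt e') = T e' false.
    by move=> /eqP ->; exact: kT.
  have mixed d1 d2 : strand src tgt b d1 = e -> strand src tgt b d2 = e ->
      e' == src d1 -> e' == tgt d2 -> False.
    case: b {de de'} => /= e1 e2 /eqP f1 /eqP f2.
      by have := st d2; rewrite e2 -e1 -f1 f2 eqxx.
    by have := st d1; rewrite e1 -e2 -f2 f1 eqxx.
  case/orP: ed => ed; case/orP: ed' => ed'.
  + by rewrite !eS.
  + by case: (mixed _ _ de de' ed ed').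
  + by case: (mixed _ _ de' de ed' ed).
  + by rewrite !eT.
- by exists g; split => // d x /eqP; exact: gE.
Qed.

Lemma arc_interpolation A src tgt pt k k' T T' :
  arc_system A src tgt pt ->
  arc_heights A src tgt pt k T -> arc_heights A src tgt pt k' T' ->
  (forall e, exists b, T e (~~ b) < T e b /\ T' e (~~ b) < T' e b) ->
  exists2 d0 : V * R -> R, shift_family d0 &
    forall d x, A d x -> d0 (x, k d x) = k' d x - k d x.
Proof.
move=> sA hk hk' ordT.
have cA d : closed (A d).
  by apply: compact_closed; [exact: norm_hausdorff | exact: arc_compact sA d].
have cU (P : set D) : closed (\bigcup_(d in P) A d).
  by apply: closed_bigcup => // ; exact: finite_finset.
pose patch (S : set V) := exists (d0 : V * R -> R) (w : V -> R),
  [/\ shift_family d0, continuous w, forall x, 0 <= w x,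
      forall x, S x -> 0 < w x &
      forall d x, 0 < w x -> A d x -> d0 (x, k d x) = k' d x - k d x].
have patch0 : patch (~` \bigcup_(d in [set: D]) A d).
  have [w [cw w0 wA]] := closed_weight (cU setT).
  exists (fun=> 0), w; split => // [|x /wA//|d x /wA nA Ax].
    by apply: (@shift_family_fst _ (fun=> 0) 0) => [|x];
      [exact: cst_continuous | rewrite normr0].
  by case: nA; exists d.
have patch1 d : patch (A d `\` \bigcup_(d' in [set d' | d' <> d]) A d').
  have [w [cw w0 wA]] := closed_weight (cU [set d' | d' <> d]).
  have [||d1 d2 x /eqP -> /eqP -> //|g [cg [C gC] gE]] := @extend_pieces R D
    (pred1 d) A (fun d x => k' d x - k d x).
  - exact: arc_compact sA.
  - move=> d'; apply/subspace_continuousP => x Ax.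
    have /subspace_continuousP/(_ x Ax) c1 := @height_cont _ _ _ _ _ _ hk' d'.
    have /subspace_continuousP/(_ x Ax) c2 := @height_cont _ _ _ _ _ _ hk d'.
    exact: cvgB c1 c2.
  exists (fun p => g p.1), w; split => // [|x [_ /wA//]|d' x /wA nA Ax].
    exact: shift_family_fst gC.
  have [dd'|dd'] := eqVneq d' d; first by apply: gE => //; exact/eqP.
  by case: nA; exists d' => //; exact/eqP.
have patch2 e : patch [set pt e].
  have [b [ltT ltT']] := ordT e.
  have [lo [clo [C1 loC] loE]] := strand_extend e (~~ b) sA hk.
  have [hi [chi [C2 hiC] hiE]] := strand_extend e b sA hk.
  have [lo' [clo' [C3 loC'] loE']] := strand_extend e (~~ b) sA hk'.
  have [hi' [chi' [C4 hiC'] hiE']] := strand_extend e b sA hk'.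
  pose m := Num.min (T e b - T e (~~ b)) (T' e b - T' e (~~ b)) / 2.
  have m0 : 0 < m by rewrite divr_gt0 // lt_min !subr_gt0 ltT.
  pose C := `|C1| + `|C2| + (`|C3| + `|C4|).
  have n1 := normr_ge0 C1; have n2 := normr_ge0 C2.
  have n3 := normr_ge0 C3; have n4 := normr_ge0 C4.
  have [||d0 sd0 d0E] := @shift_family_two R lo hi lo' hi' C m m0;
    first by split.
    move=> x; have t1 := loC x; have t2 := hiC x.
    have t3 := loC' x; have t4 := hiC' x.
    have u1 := ler_norm C1; have u2 := ler_norm C2.
    have u3 := ler_norm C3; have u4 := ler_norm C4.
    by rewrite /C; split; lra.
  have [w [cw w0 wA]] := closed_weight (cU [set d | src d <> e /\ tgt d <> e]).
  pose p1 x := Num.max 0 (hi x - lo x - m).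
  pose p2 x := Num.max 0 (hi' x - lo' x - m).
  have end_pt g kk TT b' : arc_heights A src tgt pt kk TT ->
      (forall d x, strand src tgt b' d = e -> A d x -> g x = kk d x) ->
      g (pt e) = TT e b'.
    move=> hkk gE; case: b' gE => /= gE.
      have [d de] := arc_src_surj sA e; rewrite -de (gE d) ?(height_src hkk) //.
      exact: arc_src sA d.
    have [d de] := arc_tgt_surj sA e; rewrite -de (gE d) ?(height_tgt hkk) //.
    exact: arc_tgt sA d.
  have cp (g g' : V -> R) : continuous g -> continuous g' ->
      continuous (fun x => Num.max 0 (g x - g' x - m)).
    move=> cg cg' x; apply: (@cvg_max _ _ (nbhs x)); first exact: cvg_cst.
    apply: (@cvgB _ _ _ (nbhs x)); last exact: cvg_cst.
    by apply: (@cvgB _ _ _ (nbhs x)); [exact: cg|exact: cg'].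
  have pos (r : R) : (0 < Num.max 0 r) = (0 < r) by rewrite lt_max ltxx.
  exists d0, (fun x => w x * p1 x * p2 x); split => //.
  - move=> x; apply: (@cvgM _ _ (nbhs x)); last exact: cp.
    by apply: (@cvgM _ _ (nbhs x)); [exact: cw | exact: cp].
  - by move=> x; rewrite !mulr_ge0 // le_max lexx.
  - move=> _ ->; rewrite !mulr_gt0 // ?pos.
    + apply/wA => -[d [/eqP ds /eqP dt] Ad].
      have [d' de'] := arc_src_surj sA e.
      have Ad' : A d' (pt e) by rewrite -de'; exact: arc_src sA d'.
      have dd' : d != d' by apply: contraNneq ds => ->; rewrite de'.
      have [e' [/(arc_pt_inj sA) <- + _]] := arc_meet sA dd' Ad Ad'.
      by rewrite ![e == _]eq_sym (negbTE ds) (negbTE dt).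
    + rewrite (end_pt _ _ _ _ hk hiE) (end_pt _ _ _ _ hk loE) subr_gt0.
      rewrite /m ltr_pdivrMr // gt_min; apply/orP; left.
      by rewrite mulr_natr mulr2n ltrDl subr_gt0.
    + rewrite (end_pt _ _ _ _ hk' hiE') (end_pt _ _ _ _ hk' loE') subr_gt0.
      rewrite /m ltr_pdivrMr // gt_min; apply/orP; right.
      by rewrite mulr_natr mulr2n ltrDl subr_gt0.
  - move=> d x wx Ax.
    have p1_ge0 : 0 <= p1 x by rewrite le_max lexx.
    have p2_ge0 : 0 <= p2 x by rewrite le_max lexx.
    have p2x : 0 < p2 x.
      by rewrite lt_neqAle p2_ge0 andbT; apply: contraTneq wx => <-;
        rewrite mulr0 ltxx.
    have p1x : 0 < p1 x.
      rewrite lt_neqAle p1_ge0 andbT; apply: contraTneq wx => <-.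
      by rewrite mulr0 mul0r ltxx.
    have wx0 : 0 < w x.
      rewrite lt_neqAle w0 andbT; apply: contraTneq wx => <-.
      by rewrite !mul0r ltxx.
    move: p1x p2x; rewrite !pos => p1x p2x.
    have [|| dlo dhi] := d0E x; [lra|lra|].
    have de : exists b', strand src tgt b' d = e.
      have [ds|ds] := eqVneq (src d) e; first by exists true.
      have [dt|dt] := eqVneq (tgt d) e; first by exists false.
      by case: (proj1 (wA x) wx0); exists d => //; split; exact/eqP.
    case: de => b' de; have [bb|] := eqVneq b' b.
      by rewrite bb in de; rewrite -(hiE d) // -(hiE' d).
    move=> bb; have {}bb : b' = ~~ b.
      by move: bb; case: (b'); case: (b).
    by rewrite bb in de; rewrite -(loE d) // -(loE' d).
pose S (j : option (D + E)) : set V := match j with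
  | None => ~` \bigcup_(d in [set: D]) A d
  | Some (inl d) => A d `\` \bigcup_(d' in [set d' | d' <> d]) A d'
  | Some (inr e) => [set pt e]
  end.
have patches j : patch (S j) by case: j => [[d|e]|] /=.
have cover x : exists j, S j x.
  have [[d _ Ad]|nA] := pselect ((\bigcup_(d in [set: D]) A d) x);
    last by exists None.
  have [[d' /eqP dd' Ad']|nA] :=
      pselect ((\bigcup_(d' in [set d' | d' <> d]) A d') x);
        last by exists (Some (inl d)).
  have [e [-> _ _]] := arc_meet sA dd' Ad' Ad.
  by exists (Some (inr e)).
case/choice: patches => dd /choice[w pw].
have [||||d0 sd0 d0E] := @shift_family_glue R _ w dd.
- by move=> j; case: (pw j).
- by move=> j; case: (pw j).
- by move=> x; have [j Sj] := cover x; exists j; case: (pw j) => _ _ _ + _;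
    apply.
- by move=> j; case: (pw j).
exists d0 => // d x Ad; apply: d0E => j wj; case: (pw j) => _ _ _ _; exact.
Qed.
End Arcs.

(** * The medial arcs of the pancake *)

Ltac nat_lia :=
  match goal with K : realType |- _ => clear dependent K end; lia.

Section Sectors.
Variables (R : realType) (n : nat).
Hypothesis n_ge3 : (3 <= n)%N.

Definition lon (b : nat) : R := b%:R * pi / n%:R.

Let n_neq0 : n%:R != 0 :> R.
Proof. by rewrite pnatr_eq0; lia. Qed.

Lemma lonD b m : lon (b + m) = lon b + lon m.
Proof. by rewrite /lon natrD; field. Qed.

Lemma lon_n : lon n = pi.
Proof. by rewrite /lon; field. Qed.

Lemma sin_lon_gt0 m : (0 < m < n)%N -> 0 < sin (lon m).
Proof.
move=> /andP[m0 mn]; apply: sin_gt0_pi; rewrite /lon.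
have p0 := pi_gt0 R; have n0 : 0 < n%:R :> R by rewrite ltr0n; lia.
apply/andP; split; first by rewrite !(divr_gt0, mulr_gt0) // ltr0n.
by rewrite ltr_pdivrMr // mulrC ltr_pM2l // ltr_nat.
Qed.

Lemma sin_lonDn m : sin (lon (m + n)) = - sin (lon m).
Proof. by rewrite lonD lon_n sinDpi. Qed.

Lemma cos_lon1 : 0 < cos (lon 1) < 1.
Proof.
have p0 := pi_gt0 R; have n0 : 0 < n%:R :> R by rewrite ltr0n; lia.
have n2 : 2 < n%:R :> R by rewrite ltr_nat; lia.
have l1 : 0 < lon 1 by rewrite divr_gt0 // mul1r.
have l2 : lon 1 < pi / 2 by rewrite /lon mul1r ltr_pM2l // ltf_pV2 ?posrE.
rewrite cos_gt0_pihalf; last by apply/andP; split; lra.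
by rewrite -[ltRHS]cos0 ltr_cos ?in_itv /= ?lexx; lra.
Qed.

Lemma det_lon b m :
  cos (lon b) * sin (lon (b + m)) - sin (lon b) * cos (lon (b + m)) =
  sin (lon m).
Proof.
rewrite (_ : lon m = lon (b + m) - lon b); last by rewrite lonD; ring.
by rewrite sinB; ring.
Qed.

Lemma sector_meet_le b b' (s t s' t' : R) : (b <= b' < n.*2)%N ->
  0 <= s -> 0 <= t -> 0 <= s' -> 0 <= t' -> s + t != 0 ->
  s * cos (lon b) + t * cos (lon b.+1) =
    s' * cos (lon b') + t' * cos (lon b'.+1) ->
  s * sin (lon b) + t * sin (lon b.+1) =
    s' * sin (lon b') + t' * sin (lon b'.+1) ->
  [\/ [/\ b = b', s = s' & t = t'],
      [/\ b.+1 = b', s = 0, t' = 0 & t = s'] |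
      [/\ (b + n.*2)%N = b'.+1, t = 0, s' = 0 & s = t']].
Proof.
move=> /andP[bb bn] s0 t0 s'0 t'0 st e0 e1.
have [m bE] : exists m, b' = (b + m)%N by exists (b' - b)%N; nat_lia.
pose g k := sin (lon k).
have g1 : 0 < g 1 by apply: sin_lon_gt0; nat_lia.
have g0 : g 0 = 0 by rewrite /g /lon mul0r mul0r sin0.
have eq1 : t * g 1 = s' * g m + t' * g m.+1.
  rewrite /g -(det_lon b 1) addn1 -(det_lon b m) -(det_lon b m.+1) addnS.
  have := congr2 (fun u v => cos (lon b) * v - sin (lon b) * u) e0 e1.
  by rewrite bE; lra.
have eq2 : - (s * g 1) = t' * g m +
    (if m is m'.+1 then s' * g m' else - (s' * g 1)).
  have := congr2 (fun u v => cos (lon b.+1) * v - sin (lon b.+1) * u) e0 e1.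
  have d1 : cos (lon b.+1) * sin (lon b) - sin (lon b.+1) * cos (lon b) = - g 1.
    by rewrite /g -(det_lon b 1) addn1; ring.
  case: m bE {eq1} => [|m] bE.
    rewrite addn0 in bE; rewrite bE => e; move: e d1; rewrite g0; nra.
  have d2 := det_lon b.+1 m; have d3 := det_lon b.+1 m.+1.
  have E1 : b' = (b.+1 + m)%N by nat_lia.
  have E2 : b'.+1 = (b.+1 + m.+1)%N by nat_lia.
  move=> e; rewrite E2 E1 in e; rewrite /g -d2 -d3 -/(g 1).
  have -> : - (s * g 1) = s * (- g 1) by ring.
  by rewrite -d1; lra.
have gpos k : (0 < k < n)%N -> 0 < g k by exact: sin_lon_gt0.
have gD k : g (k + n)%N = - g k by exact: sin_lonDn.
have sg0 (r : R) : r * g 1 = 0 -> r = 0.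
  by move=> /eqP; rewrite mulf_eq0 (gt_eqF g1) orbF => /eqP.
have mul0 (r k : R) : 0 <= r -> 0 < k -> r * k <= 0 -> r = 0.
  move=> r0 k0; rewrite pmulr_lle0 // => r0'.
  by apply/eqP; rewrite eq_le r0 r0'.
have sg (r k : R) : 0 <= r -> 0 <= k -> 0 <= r * k by exact: mulr_ge0.
have g1' := ltW g1.
have [m0|m_gt0] := posnP m.
  constructor 1; rewrite m0 in eq1 eq2 bE; split; first by nat_lia.
    by apply/eqP; rewrite -subr_eq0; apply/eqP/sg0; rewrite g0 in eq2; lra.
  by apply/eqP; rewrite -subr_eq0; apply/eqP/sg0; rewrite g0 in eq1; lra.
have [m1|m_neq1] := eqVneq m 1%N.
  constructor 2; rewrite m1 /= g0 in eq1 eq2.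
  have z1 : s * g 1 = 0.
    by have := sg _ _ s0 g1'; have := sg _ _ t'0 g1'; lra.
  have z2 : t' * g 1 = 0.
    by have := sg _ _ s0 g1'; have := sg _ _ t'0 g1'; lra.
  have t'z := sg0 _ z2; split; [by nat_lia|exact: sg0|by []|].
  apply/eqP; rewrite -subr_eq0; apply/eqP/sg0.
  by rewrite t'z in eq1; lra.
have [mn|mn] := ltnP m n.
  have g2 : 0 < g m by apply: gpos; nat_lia.
  have g3 : 0 < g m.-1 by apply: gpos; nat_lia.
  rewrite -(prednK m_gt0) in eq2; rewrite prednK // in eq2.
  have h1 := sg _ _ s0 g1'; have h2 := sg _ _ t'0 (ltW g2).
  have h3 := sg _ _ s'0 (ltW g3).
  have sz : s = 0 by apply: (mul0 _ _ s0 g1); lra.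
  have t'z : t' = 0 by apply: (mul0 _ _ t'0 g2); lra.
  have s'z : s' = 0 by apply: (mul0 _ _ s'0 g3); lra.
  move: st; rewrite sz t'z s'z in eq1 *; rewrite !mul0r addr0 in eq1.
  by rewrite (sg0 _ eq1) addr0 eqxx.
have [m' mE] : exists m', m = (m' + n)%N by exists (m - n)%N; nat_lia.
have [m'0|m'_gt0] := posnP m'.
  have g3 : 0 < g m.-1 by apply: gpos; nat_lia.
  have g2 : g m = 0 by rewrite mE gD m'0 g0 oppr0.
  have g4 : g m.+1 = - g 1 by rewrite mE m'0 -addSn gD.
  rewrite -(prednK m_gt0) in eq2; rewrite prednK // in eq2.
  rewrite g2 g4 in eq1 eq2.
  have h1 := sg _ _ s0 g1'; have h2 := sg _ _ s'0 (ltW g3).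
  have h3 := sg _ _ t0 g1'; have h4 := sg _ _ t'0 g1'.
  have sz : s = 0 by apply: (mul0 _ _ s0 g1); lra.
  have tz : t = 0 by apply: (mul0 _ _ t0 g1); lra.
  by move: st; rewrite sz tz addr0 eqxx.
have g2 : g m = - g m' by rewrite mE gD.
have g4 : g m.+1 = - g m'.+1 by rewrite mE -addSn gD.
have gm' : 0 < g m' by apply: gpos; nat_lia.
have h1 := sg _ _ t0 g1'; have h2 := sg _ _ s'0 (ltW gm').
rewrite g2 g4 in eq1.
have [m'n|m'n] := ltnP m'.+1 n.
  have gm'1 : 0 < g m'.+1 by apply: gpos; nat_lia.
  have h3 := sg _ _ t'0 (ltW gm'1).
  have tz : t = 0 by apply: (mul0 _ _ t0 g1); lra.
  have s'z : s' = 0 by apply: (mul0 _ _ s'0 gm'); lra.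
  have t'z : t' = 0 by apply: (mul0 _ _ t'0 gm'1); lra.
  rewrite -(prednK m_gt0) in eq2; rewrite prednK // in eq2.
  rewrite s'z t'z !mul0r addr0 in eq2.
  have sz : s = 0 by apply: sg0; lra.
  by move: st; rewrite sz tz addr0 eqxx.
have m'E : m'.+1 = n by nat_lia.
have g5 : g n = 0 by rewrite -[n]add0n gD g0 oppr0.
rewrite m'E g5 in eq1.
constructor 3.
have tz : t = 0 by apply: (mul0 _ _ t0 g1); lra.
have s'z : s' = 0 by apply: (mul0 _ _ s'0 gm'); lra.
have g6 : g m = - g 1.
  rewrite g2; congr (- _); rewrite /g -[in LHS](_ : (n - 1)%N = m');
    last by nat_lia.
  have -> : lon (n - 1) = pi - lon 1.
    by rewrite -lon_n -[X in lon X - _](@subnK 1 n) ?lonD ?addrK //; nat_lia.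
  by rewrite sinB sinpi cospi; ring.
rewrite -(prednK m_gt0) in eq2; rewrite prednK // in eq2.
rewrite s'z mul0r addr0 g6 in eq2.
split => //; first by nat_lia.
by apply/eqP; rewrite -subr_eq0; apply/eqP/sg0; lra.
Qed.

Lemma lon_period b : lon (b + n.*2) = lon b + pi *+ 2.
Proof. by rewrite lonD -addnn lonD lon_n mulr2n. Qed.

Lemma sector_meet b b' (s t s' t' : R) : (b < n.*2)%N -> (b' < n.*2)%N ->
  0 <= s -> 0 <= t -> 0 <= s' -> 0 <= t' -> s + t != 0 -> s' + t' != 0 ->
  s * cos (lon b) + t * cos (lon b.+1) =
    s' * cos (lon b') + t' * cos (lon b'.+1) ->
  s * sin (lon b) + t * sin (lon b.+1) =
    s' * sin (lon b') + t' * sin (lon b'.+1) ->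
  [\/ [/\ b = b', s = s' & t = t'],
      [/\ b.+1 = b' %[mod n.*2], s = 0, t' = 0 & t = s'] |
      [/\ b = b'.+1 %[mod n.*2], t = 0, s' = 0 & s = t']].
Proof.
move=> bn b'n s0 t0 s'0 t'0 st st' e0 e1; have [bb|bb] := leqP b b'.
  have bb' : (b <= b' < n.*2)%N by rewrite bb.
  have [[-> -> ->]|[-> -> -> ->]|[bE -> -> ->]] :=
    sector_meet_le bb' s0 t0 s'0 t'0 st e0 e1.
  - by constructor 1.
  - by constructor 2.
  - by constructor 3; split => //; rewrite -bE modnDr.
have bb' : (b' <= b < n.*2)%N by rewrite bn ltnW.
have [[-> -> ->]|[-> -> -> ->]|[bE -> -> ->]] :=
  sector_meet_le bb' s'0 t'0 s0 t0 st' (esym e0) (esym e1).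
- by constructor 1.
- by constructor 3.
- by constructor 2; split => //; rewrite -bE modnDr.
Qed.

Section Cells.
Variable l : nat.
Hypothesis l_gt0 : (0 < l)%N.

Let th : R := pi / (l.*2.+1)%:R.
Notation north := (cos th / sin th / cos (lon 1)).

(* The point at longitude b on the line of the sphere point (a, b), scaled to
   be at distance 1 from the axis: height is then a cotangent.  For a = 0 and
   a = 2l + 1 it is the point where the plane through the axis at longitude b
   cuts the great-circle arc from (1, b - 1) to (1, b + 1), resp. from
   (2l, b - 1) to (2l, b + 1). *)
Definition height (a : nat) : R :=
  if a == 0%N then north
  else if a == l.*2.+1 then - north
  else cos (a%:R * th) / sin (a%:R * th).

Definition axpt (a b : nat) : space3 R :=
  vec3 (cos (lon b)) (sin (lon b)) (height a).

Lemma axpt_period a b b' : b = b' %[mod n.*2] -> axpt a b = axpt a b'.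
Proof.
have H m k : axpt a (m + k * n.*2) = axpt a m.
  elim: k => [|k IH]; first by rewrite mul0n addn0.
  rewrite mulSn [(n.*2 + _)%N]addnC addnA -IH /axpt lon_period.
  rewrite mulr2n addrA.
  by rewrite !sinDpi !cosDpi !opprK.
rewrite (divn_eq b n.*2) (divn_eq b' n.*2) => e.
by rewrite ![(_ * _ + _)%N]addnC !H; move: e; rewrite !modnMDl !modn_mod => ->.
Qed.

Lemma sin_colat_gt0 a : (0 < a < l.*2.+1)%N -> 0 < sin (a%:R * th).
Proof.
move=> /andP[a0 al]; apply: sin_gt0_pi.
have p0 := pi_gt0 R; have l0 : 0 < (l.*2.+1)%:R :> R by rewrite ltr0n.
apply/andP; split; first by rewrite !(divr_gt0, mulr_gt0) // ltr0n.
by rewrite /th mulrA ltr_pdivrMr // mulrC ltr_pM2l // ltr_nat.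
Qed.

Lemma colat_flip a : (a <= l.*2.+1)%N ->
  (l.*2.+1 - a)%:R * th = pi - a%:R * th.
Proof.
move=> al; have l0 : (l.*2.+1)%:R != 0 :> R by rewrite pnatr_eq0.
by rewrite natrB // /th; field.
Qed.

Lemma height_flip a : (a <= l.*2.+1)%N -> height (l.*2.+1 - a) = - height a.
Proof.
move=> al; rewrite /height subn_eq0.
have [a0|a0] := posnP a; first by rewrite a0 subn0 eqxx.
have [->|al'] := eqVneq a l.*2.+1.
  by rewrite leqnn opprK.
have lt_al : (a < l.*2.+1)%N by rewrite ltn_neqAle al' al.
rewrite leqNgt lt_al /= ifF; last by apply/eqP; lia.
by rewrite colat_flip // cosB sinB sinpi cospi; field;
  rewrite gt_eqF // sin_colat_gt0 // a0.
Qed.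

Lemma height1_gt0 : 0 < height 1.
Proof.
rewrite /height /= ifF; last by apply/eqP; lia.
rewrite divr_gt0 //; last by apply: sin_colat_gt0; lia.
have p0 := pi_gt0 R; have l0 : 0 < (l.*2.+1)%:R :> R by rewrite ltr0n.
have l2 : 2 < (l.*2.+1)%:R :> R by rewrite ltr_nat; lia.
apply: cos_gt0_pihalf; rewrite mul1r /th; apply/andP; split.
  by apply: (@lt_trans _ _ 0); [lra | rewrite divr_gt0].
by rewrite ltr_pM2l // ltf_pV2 ?posrE.
Qed.

Lemma height0 : height 1 = height 0 * cos (lon 1).
Proof.
have /andP[c0 _] := cos_lon1.
rewrite /height /= ifF; last by apply/eqP; lia.
by rewrite mul1r divfK // gt_eqF.
Qed.

Lemma height_dec_mid a a' : (0 < a)%N -> (a < a')%N -> (a' < l.*2.+1)%N ->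
  height a' < height a.
Proof.
move=> a0 aa' al; rewrite /height.
have -> : (a == 0)%N = false by lia.
have -> : (a' == 0)%N = false by lia.
have -> : (a == l.*2.+1)%N = false by lia.
have -> : (a' == l.*2.+1)%N = false by lia.
have s1 : 0 < sin (a%:R * th) by apply: sin_colat_gt0; lia.
have s2 : 0 < sin (a'%:R * th) by apply: sin_colat_gt0; lia.
have s3 : 0 < sin (a'%:R * th - a%:R * th).
  by rewrite -mulrBl -natrB ?(ltnW aa') //; apply: sin_colat_gt0; lia.
rewrite -subr_gt0 (_ : _ - _ = sin (a'%:R * th - a%:R * th) /
    (sin (a%:R * th) * sin (a'%:R * th)));
      first by rewrite !(divr_gt0, mulr_gt0).
by rewrite sinB; field; rewrite !gt_eqF.
Qed.

Lemma height_dec a a' : (a < a')%N -> (a' <= l.*2.+1)%N -> height a' < height a.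
Proof.
have top : height 1 < height 0.
  have /andP[c0 c1] := cos_lon1; have h1 := height1_gt0;
    rewrite height0 in h1 *.
  by rewrite -[ltRHS]mulr1 ltr_pM2l //; move: h1; rewrite pmulr_lgt0.
have h1 := height1_gt0.
have pos a0 : (a0 <= 1)%N -> 0 < height a0.
  by case: a0 => [|[|//]] _ //; exact: lt_trans top.
have dec0 a0 : (0 < a0)%N -> (a0 < l.*2.+1)%N -> height a0 < height 0.
  move=> a00 al; have [->//|a1] := eqVneq a0 1%N.
  by apply: lt_trans top; apply: height_dec_mid => //; lia.
move=> aa' al; have [a'E|a'E] := eqVneq a' l.*2.+1.
  rewrite a'E -[height l.*2.+1]opprK -height_flip // subnn.
  have -> : a = (l.*2.+1 - (l.*2.+1 - a))%N by lia.
  rewrite height_flip; last by lia.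
  rewrite ltrN2; have [a0|a0] := posnP a; last by apply: dec0; lia.
  rewrite a0 subn0; have := pos 0%N isT.
  have := height_flip (leq0n _); rewrite subn0 => ->; lra.
have [a0|a0] := posnP a; last by apply: height_dec_mid => //; lia.
by rewrite a0; apply: dec0; lia.
Qed.

Lemma height_inj a a' : (a <= l.*2.+1)%N -> (a' <= l.*2.+1)%N ->
  height a = height a' -> a = a'.
Proof.
move=> al a'l e; have [aa|aa|//] := ltngtP a a'.
  by have := height_dec aa a'l; rewrite e ltxx.
by have := height_dec aa al; rewrite e ltxx.
Qed.

Lemma gridE a b : (0 < a < l.*2.+1)%N ->
  grid R n l a b = sin (a%:R * th) *: axpt a b.
Proof.
move=> al; have s0 := sin_colat_gt0 al; rewrite /grid /axpt /height.
rewrite -mulrA -/th -/(lon b).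
have -> : (a == 0)%N = false by lia.
have -> : (a == l.*2.+1)%N = false by lia.
apply/rowP => -[[|[|[|//]]] i]; rewrite !mxE //=.
by field; rewrite gt_eqF.
Qed.

(* The levels of the left and right ends of the k-th of the segments that
   zigzag between the meridians b and b + 1. *)
Definition lft (k b : nat) : nat := if odd (k + b) then k else k.+1.
Definition rgt (k b : nat) : nat := if odd (k + b) then k.+1 else k.

Lemma lft_odd k b : odd (k + b) -> lft k b = k.
Proof. by rewrite /lft => ->. Qed.

Lemma lft_even k b : ~~ odd (k + b) -> lft k b = k.+1.
Proof. by rewrite /lft => /negbTE ->. Qed.

Lemma rgt_odd k b : odd (k + b) -> rgt k b = k.+1.
Proof. by rewrite /rgt => ->. Qed.

Lemma rgt_even k b : ~~ odd (k + b) -> rgt k b = k.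
Proof. by rewrite /rgt => /negbTE ->. Qed.

Lemma lft_le k b m : (k <= m)%N -> (lft k b <= m.+1)%N.
Proof. by rewrite /lft; case: ifP => _; nat_lia. Qed.

Lemma rgt_le k b m : (k <= m)%N -> (rgt k b <= m.+1)%N.
Proof. by rewrite /rgt; case: ifP => _; nat_lia. Qed.

Lemma lft_mono k k' b : (k < k')%N -> (lft k b <= lft k' b)%N.
Proof. by rewrite /lft; do 2 case: ifP => _; nat_lia. Qed.

Lemma rgt_mono k k' b : (k < k')%N -> (rgt k b <= rgt k' b)%N.
Proof. by rewrite /rgt; do 2 case: ifP => _; nat_lia. Qed.

Lemma lft_rgt k b : (lft k b + rgt k b = k.*2.+1)%N.
Proof. by rewrite /lft /rgt; case: ifP => _; nat_lia. Qed.

Definition corner k b a c : bool :=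
  ((lft k b == a) && (b == c %[mod n.*2])) ||
  ((rgt k b == a) && (b.+1 == c %[mod n.*2])).

Lemma cell_meet k b k' b' (s t s' t' : R) x : x != 0 ->
  (k <= l.*2)%N -> (k' <= l.*2)%N -> (b < n.*2)%N -> (b' < n.*2)%N ->
  0 <= s -> 0 <= t -> 0 <= s' -> 0 <= t' ->
  x = s *: axpt (lft k b) b + t *: axpt (rgt k b) b.+1 ->
  x = s' *: axpt (lft k' b') b' + t' *: axpt (rgt k' b') b'.+1 ->
  [\/ k = k' /\ b = b', s = 0 /\ corner k' b' (rgt k b) b.+1 |
      t = 0 /\ corner k' b' (lft k b) b].
Proof.
move=> x0 kl k'l bn b'n s0 t0 s'0 t'0 xE xE'.
have nz (u v : R) p q : 0 <= u -> 0 <= v -> x = u *: p + v *: q -> u + v != 0.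
  move=> u0 v0 e; apply: contra_neq x0 => uv; rewrite e.
  have -> : u = 0 by lra.
  have -> : v = 0 by lra.
  by rewrite !scale0r addr0.
have st := nz _ _ _ _ s0 t0 xE; have st' := nz _ _ _ _ s'0 t'0 xE'.
have E := esym xE; rewrite xE' in E.
have e0 := congr1 (fun y : space3 R => y 0 0) E.
have e1 := congr1 (fun y : space3 R => y 0 1) E.
have e2 := congr1 (fun y : space3 R => y 0 2%R) E.
rewrite !mxE /= in e0 e1 e2.
have kL c := lft_le c kl; have kR c := rgt_le c kl.
have k'L c := lft_le c k'l; have k'R c := rgt_le c k'l.
have [[bb ss tt]|[bb sz t'z ts]|[bb tz s'z ts]] :=
  sector_meet bn b'n s0 t0 s'0 t'0 st st' e0 e1.
- have [kk|kk] := eqVneq k k'; first by constructor 1.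
  rewrite -ss -tt -bb in e2 *.
  have e3 : s * (height (lft k b) - height (lft k' b)) +
            t * (height (rgt k b) - height (rgt k' b)) = 0 by lra.
  have zero_or (r : R) a a' : (a <= l.*2.+1)%N -> (a' <= l.*2.+1)%N ->
      r * (height a - height a') = 0 -> r = 0 \/ a = a'.
    move=> al a'l /eqP; rewrite mulf_eq0 subr_eq0 => /orP[/eqP|/eqP h].
      by left.
    by right; apply: height_inj.
  have ge (r : R) a a' : 0 <= r -> (a <= a')%N -> (a' <= l.*2.+1)%N ->
      0 <= r * (height a - height a').
    move=> r0 aa al; apply: mulr_ge0 => //; rewrite subr_ge0.
    move: aa; rewrite leq_eqVlt => /predU1P[->//|aa].
    by rewrite ltW // height_dec.
  have [z1 z2] : s * (height (lft k b) - height (lft k' b)) = 0 /\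
                 t * (height (rgt k b) - height (rgt k' b)) = 0.
    case: (ltngtP k k') => kk'; last by rewrite kk' eqxx in kk.
      have g1 := ge s _ _ s0 (lft_mono b kk') (k'L b).
      have g2 := ge t _ _ t0 (rgt_mono b kk') (k'R b).
      by split; lra.
    have g1 := ge s _ _ s0 (lft_mono b kk') (kL b).
    have g2 := ge t _ _ t0 (rgt_mono b kk') (kR b).
    by split; lra.
  have [sz|lE] := zero_or _ _ _ (kL b) (k'L b) z1;
    have [tz|rE] := zero_or _ _ _ (kR b) (k'R b) z2.
  + by rewrite sz tz addr0 eqxx in st.
  + by constructor 2; rewrite /corner rE !eqxx orbT.
  + by constructor 3; rewrite /corner lE !eqxx.
  + case/eqP: kk; have := lft_rgt k b; rewrite lE rE lft_rgt => -[].
    by move/double_inj.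
- constructor 2; split => //; rewrite /corner; apply/orP; left.
  rewrite bb eqxx andbT; apply/eqP/height_inj => //.
  have t_neq0 : t != 0 by rewrite sz add0r in st.
  apply: (mulfI t_neq0); rewrite {1}ts.
  by rewrite sz t'z !mul0r add0r addr0 in e2.
- constructor 3; split => //; rewrite /corner; apply/orP; right.
  rewrite bb eqxx andbT; apply/eqP/height_inj => //.
  have s_neq0 : s != 0 by rewrite tz addr0 in st.
  apply: (mulfI s_neq0); rewrite {1}ts.
  by rewrite tz s'z !mul0r add0r addr0 in e2.
Qed.

End Cells.
End Sectors.

Section PancakeArcs.
Variables (R : realType) (n l : nat).
Hypotheses (n_ge3 : (3 <= n)%N) (l_gt0 : (0 < l)%N).
Notation V := (space3 R).
Notation G := (pancake R n l).
Implicit Types (d : pedges n l * bool) (e : pedges n l).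

Let ax := @axpt R n l.
Let C1 : R := cos (lon R n 1).

Lemma ord_predE m (i : 'I_m) : ord_pred i = (if i == 0 :> nat then m.-1 else
  i.-1)%N :> nat.
Proof.
have im := ltn_ord i; rewrite /=; case: eqP => [->|/eqP i0].
  by rewrite add0n modn_small //; lia.
have -> : ((i + m).-1 = i.-1 + m)%N by lia.
by rewrite modnDr modn_small //; lia.
Qed.

Lemma ordSE m (i : 'I_m) : ordS i = (if i.+1 == m then 0 else i.+1)%N :> nat.
Proof.
have im := ltn_ord i; rewrite /=; case: eqP => [->|/eqP i0].
  by rewrite modnn.
by rewrite modn_small //; lia.
Qed.

Definition pancake_cw d : pedges n l * bool :=
  match d with
  | (Spoke i j, false) =>
      if j == 0%N :> nat then (Spoke (ord_pred i) j, false)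
      else (Ring (ord_pred i) (ord_pred j), true)
  | (Spoke i j, true) => (Ring i j, false)
  | (Ring i j, true) => (Spoke (ordS i) j, true)
  | (Ring i j, false) =>
      if j.+1 == l then (Ring (ord_pred i) j, true)
      else (Spoke i (ordS j), false)
  end.

Lemma pancake_cwK : cancel pancake_cw (@pancake_ccw n l).
Proof.
case=> [[[i j]|[i j]] []]; have jl := ltn_ord j; rewrite /pancake_cw /=.
- by rewrite ordSK.
- case: ifP => h /=; first by rewrite h ord_predK.
  rewrite ifF; first by rewrite ordSK.
  by have := ordSE j; rewrite h /= => ->.
- by [].
- case: ifP => h /=; first by rewrite h ord_predK.
  rewrite ifF; first by rewrite !ord_predK.
  by have := ord_predE j; rewrite h /= => ->; lia.
Qed.

Lemma pancake_ccwK : cancel (@pancake_ccw n l) pancake_cw.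
Proof. exact/canF_sym/pancake_cwK. Qed.

Lemma pancake_ccw_edge d : (pancake_ccw d).1 != d.1.
Proof.
have ne (i : 'I_n) : ordS i != i.
  apply/eqP => /(congr1 val) /= h; have := ordSE i; rewrite /= h.
  by have := ltn_ord i; case: ifP; lia.
case: d => [[[i j]|[i j]] []] //=; case: ifP => _ //=;
  apply/eqP => -[] => /eqP; exact/negP.
Qed.

Definition epos e : nat * nat :=
  match e with
  | Ring i j => (j.+1.*2, i.*2.+1)
  | Spoke i j => (j.*2.+1, i.*2)
  end.

Lemma epos_bound e : (0 < (epos e).1 < l.*2.+1)%N /\ ((epos e).2 < n.*2)%N.
Proof.
by case: e => [[i j]|[i j]] /=; have := ltn_ord i; have := ltn_ord j; lia.
Qed.

Lemma epos_inj : injective epos.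
Proof.
move=> [[i j]|[i j]] [[i' j']|[i' j']] //= [e1 e2]; try by lia.
  by congr (inl (_, _)); apply/val_inj => /=; lia.
by congr (inr (_, _)); apply/val_inj => /=; lia.
Qed.

Lemma eptE e : @ept R G e = grid R n l (epos e).1 (epos e).2.
Proof. by case: e => [[i j]|[i j]]. Qed.

Lemma ept_axpt e : exists2 r : R, 0 < r &
  @ept R G e = r *: ax (epos e).1 (epos e).2.
Proof.
have [ab _] := epos_bound e; rewrite eptE gridE //.
by eexists; last reflexivity; exact: sin_colat_gt0.
Qed.

Lemma ept_inj : injective (@ept R G).
Proof.
move=> e e' E; apply: epos_inj; move: E.
have [ab b_lt] := epos_bound e; have [ab' b'_lt] := epos_bound e'.
case: (ept_axpt e) => r r0 ->; case: (ept_axpt e') => r' r'0 ->.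
case: (epos e) ab b_lt => a b /= ab b_lt;
  case: (epos e') ab' b'_lt => a' b' /= ab' b'_lt E.
have e0 := congr1 (fun y : V => y 0 0) E.
have e1 := congr1 (fun y : V => y 0 1) E.
have e2 := congr1 (fun y : V => y 0 2%R) E.
rewrite !mxE /= in e0 e1 e2.
have [||||[bb rr _]|[_ z _ _]|[_ _ z _]] := @sector_meet R n n_ge3 b b' r 0 r' 0
  b_lt b'_lt (ltW r0) (lexx 0) (ltW r'0) (lexx 0).
- by rewrite addr0 gt_eqF.
- by rewrite addr0 gt_eqF.
- by rewrite !mul0r !addr0.
- by rewrite !mul0r !addr0.
- rewrite bb; congr pair.
  apply: (@height_inj R n n_ge3 l l_gt0); [by lia|by lia|].
  by apply: (mulfI (lt0r_neq0 r0)); rewrite e2 rr.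
- by move: r0; rewrite z ltxx.
- by move: r'0; rewrite z ltxx.
Qed.

(* The segments (k, b) onto which the medial arc of the corner d projects from
   the origin.  The arcs facing the poles span two sectors; they are cut in the
   middle, at the level 0 or 2l + 1. *)
Definition cell d (k b : nat) : bool :=
  match d with
  | (Spoke i j, false) =>
      if j == 0%N :> nat then (k == 0)%N && ((b == i.*2) || (b == i.*2.+1))
      else (k == j.*2) && (b == i.*2)
  | (Ring i j, false) => (k == j.*2.+1) && (b == i.*2)
  | (Spoke i j, true) =>
      (k == j.*2.+1) && (b == if i == 0%N :> nat then n.*2.-1 else i.*2.-1)
  | (Ring i j, true) =>
      if j.+1 == l then
        (k == l.*2) && ((b == i.*2.+1) || (b == if i.+1 == n then 0 else
          i.+1.*2)%N)
      else (k == j.+1.*2) && (b == i.*2.+1)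
  end.

Lemma cell_bound d k b : cell d k b -> (k <= l.*2)%N /\ (b < n.*2)%N.
Proof.
case: d => [[[i j]|[i j]] []] /=; have := ltn_ord i; have := ltn_ord j;
  repeat case: ifP; lia.
Qed.

Lemma cell_inj d d' k b : cell d k b -> cell d' k b -> d = d'.
Proof.
have ord_eq m (i i' : 'I_m) : i = i' :> nat -> i = i' by move=> ?;
  exact/val_inj.
case: d => [[[i j]|[i j]] []]; case: d' => [[[i' j']|[i' j']] []] /=;
  have := ltn_ord i; have := ltn_ord j; have := ltn_ord i'; have := ltn_ord j';
  move=> ? ? ? ? h h';
  first [ by exfalso; move: h h'; repeat case: ifP; lia
        | first [congr (inl (_, _), _) | congr (inr (_, _), _)];
          apply: ord_eq; move: h h'; repeat case: ifP; lia ].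
Qed.

Definition mid_of (C : nat -> nat -> bool) a c :=
  forall k b, (k <= l.*2)%N -> (b < n.*2)%N -> corner n k b a c -> C k b.

(* For the point x = u P + v P' of an arc with ends P and P': only at P, P' or
   the middle of the arc can x lie on the boundary of a cone over a segment. *)
Definition in_cell (C : nat -> nat -> bool) (u v : R) (x : V) :=
  exists k b (s t : R), [/\ C k b, 0 <= s, 0 <= t,
    x = s *: ax (lft k b) b + t *: ax (rgt k b) b.+1 &
    [/\ s = 0 -> [\/ u = 0, v = 0 | mid_of C (rgt k b) b.+1],
        t = 0 -> [\/ u = 0, v = 0 | mid_of C (lft k b) b] &
        s = 0 -> t = 0 -> u = 0 /\ v = 0]].

Lemma in_cell_sym C u v x : in_cell C u v x -> in_cell C v u x.
Proof.
case=> k [b [s [t [Ckb s0 t0 xE [hs ht hst]]]]].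
exists k, b, s, t; split => //; split.
- by case/hs => ?; [constructor 2|constructor 1|constructor 3].
- by case/ht => ?; [constructor 2|constructor 1|constructor 3].
- by move=> sz tz; have [] := hst sz tz.
Qed.

Lemma in_cell_side (C : nat -> nat ->
  bool) k b p q c (r r' u v : R) : C k b -> 0 < r -> 0 < r' ->
  0 <= u -> 0 <= v -> lft k b = p -> rgt k b = q -> b.+1 = c %[mod n.*2] ->
  in_cell C u v (u *: (r *: ax p b) + v *: (r' *: ax q c)).
Proof.
move=> Ckb r0 r'0 u0 v0 <- <- bc; exists k, b, (u * r), (v * r').
have z (a a' : R) : 0 < a' -> a * a' = 0 -> a = 0.
  by move=> a'0 /eqP; rewrite mulf_eq0 (gt_eqF a'0) orbF => /eqP.
split => //; first by rewrite mulr_ge0 // ltW.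
- by rewrite mulr_ge0 // ltW.
- by rewrite !scalerA /ax (axpt_period R n_ge3 l _ bc).
split.
- by move=> /(z _ _ r0) ->; constructor 1.
- by move=> /(z _ _ r'0) ->; constructor 2.
- by move=> /(z _ _ r0) -> /(z _ _ r'0) ->.
Qed.

Lemma axpt_mid a m b : height R n l a = height R n l m * C1 ->
  ax a b + ax a b.+2 = (C1 *+ 2) *: ax m b.+1.
Proof.
move=> h; rewrite /ax /axpt h.
have -> : lon R n b = lon R n b.+1 - lon R n 1 by rewrite -[b.+1]addn1 lonD //
  addrK.
have -> : lon R n b.+2 = lon R n b.+1 + lon R n 1 by rewrite -lonD // addn1.
rewrite cosB sinB cosD sinD -/C1.
by apply/rowP => -[[|[|[|//]]] i]; rewrite !mxE /=; ring.
Qed.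

Lemma in_cell_cap (C : nat -> nat ->
  bool) k b b' a m c (r u v : R) : C k b -> C k b' -> 0 < r ->
  0 <= u -> 0 <= v -> height R n l a = height R n l m * C1 ->
  lft k b = a -> rgt k b = m -> lft k b' = m -> rgt k b' = a ->
  b.+1 = b' %[mod n.*2] -> b.+2 = c %[mod n.*2] -> mid_of C m b.+1 ->
  in_cell C u v (u *: (r *: ax a b) + v *: (r *: ax a c)).
Proof.
move=> Ckb Ckb' r0 u0 v0 h lE rE lE' rE' bb' bc mid.
have /andP[c0 _] := cos_lon1 R n_ge3; rewrite -/C1 in c0.
have bc' : b'.+1 = c %[mod n.*2].
  by rewrite -bc -[b.+2]addn1 -modnDml bb' modnDml addn1.
have z (x y : R) : 0 < y -> x * y = 0 -> x = 0.
  by move=> y0 /eqP; rewrite mulf_eq0 (gt_eqF y0) orbF => /eqP.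
have rc : 0 < r * (C1 *+ 2) by rewrite mulr_gt0 // pmulrn_lgt0.
have mid' : mid_of C m b' by move=> k1 b1 k1l b1n cor; apply: mid => //;
  rewrite /corner !bb'.
rewrite -/(ax a c) /ax -(axpt_period R n_ge3 l _ bc) -/ax -/(ax a b) -/(ax a
  b.+2).
have aE : ax a b.+2 = (C1 *+ 2) *: ax m b.+1 - ax a b.
  by rewrite -(axpt_mid b h) addrC addKr.
have aE' : ax a b = (C1 *+ 2) *: ax m b.+1 - ax a b.+2.
  by rewrite -(axpt_mid b h) addrK.
have [vu|uv] := leP v u.
  exists k, b, ((u - v) * r), (v * (r * (C1 *+ 2))); split => //.
  - by rewrite mulr_ge0 ?subr_ge0 // ltW.
  - by rewrite mulr_ge0 // ltW.
  - rewrite lE rE aE; apply/rowP => j; rewrite !mxE; ring.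
  split.
  - by rewrite rE; constructor 3.
  - by move=> /(z _ _ rc) ->; constructor 2.
  - by move=> /(z _ _ r0) e /(z _ _ rc) ve; split => //; lra.
exists k, b', (u * (r * (C1 *+ 2))), ((v - u) * r); split => //.
- by rewrite mulr_ge0 // ltW.
- by rewrite mulr_ge0 ?subr_ge0 // ltW.
- rewrite lE' rE' aE' /ax -(axpt_period R n_ge3 l m bb') (axpt_period R n_ge3
    l a bc').
  rewrite -(axpt_period R n_ge3 l a bc).
  by apply/rowP => j; rewrite !mxE; ring.
split.
- by move=> /(z _ _ rc) ->; constructor 1.
- by rewrite lE'; constructor 3.
- by move=> /(z _ _ rc) e /(z _ _ r0) ve; split => //; lra.
Qed.

Let rad e : R := sin ((epos e).1%:R * (pi / (l.*2.+1)%:R)).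

Lemma rad_gt0 e : 0 < rad e.
Proof. by have [ab _] := epos_bound e; exact: sin_colat_gt0. Qed.

Lemma ept_rad e : @ept R G e = rad e *: ax (epos e).1 (epos e).2.
Proof. by have [ab _] := epos_bound e; rewrite eptE gridE. Qed.

Lemma ordS_double (i : 'I_n) : i.+1.*2 = (ordS i).*2 %[mod n.*2].
Proof.
by rewrite ordSE; case: eqP => [->|//]; rewrite double0 modnn mod0n.
Qed.

Lemma ordS_doubleS (i : 'I_n) : i.+1.*2.+1 = (ordS i).*2.+1 %[mod n.*2].
Proof. by rewrite -addn1 -modnDml ordS_double modnDml addn1. Qed.

Lemma height_last : height R n l l.*2 = height R n l l.*2.+1 * C1.
Proof.
have e1 : height R n l l.*2 = - height R n l 1.
  by rewrite -height_flip ?subn1.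
have e2 : height R n l l.*2.+1 = - height R n l 0.
  by rewrite -height_flip ?subn0.
by rewrite e1 e2 mulNr height0.
Qed.

Lemma mod_succ_inj b c : (b < n.*2)%N -> (c < n.*2)%N ->
  b.+1 = c.+1 %[mod n.*2] -> b = c.
Proof.
move=> bn cn /eqP; rewrite -addn1 -[c.+1]addn1 eqn_modDr => /eqP.
by rewrite !modn_small.
Qed.

Lemma mod_double_lt b c : (b < n.*2)%N -> (c < n.*2)%N ->
  b = c %[mod n.*2] -> b = c.
Proof. by move=> bn cn; rewrite !modn_small. Qed.

Lemma med_arc_in_cell d (u v : R) : 0 <= u -> 0 <= v ->
  in_cell (cell d) u v (u *: @ept R G d.1 + v *: @ept R G (pancake_ccw d).1).
Proof.
move=> u0 v0; rewrite !ept_rad.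
have odd2 m : odd m.*2 = false by exact: odd_double.
have oddS i j : odd (i.*2 + j.*2) = false by rewrite oddD !odd_double.
case: d => [[[i j]|[i j]] []]; have jl := ltn_ord j; have il := ltn_ord i.
- have [jl'|jl'] := eqVneq j.+1 l.
    rewrite /pancake_ccw jl' eqxx /= jl'.
    have h1 := rad_gt0 (Ring i j); rewrite {1}/rad /= jl' in h1.
    rewrite /rad /= jl'.
    apply: (@in_cell_cap _ l.*2 i.*2.+1 (ordS i).*2 l.*2 l.*2.+1) => //.
    + by rewrite /= jl' eqxx !eqxx.
    + rewrite /= jl' eqxx eqxx /=; apply/orP; right;
        rewrite -/(nat_of_ord (ordS i)).
      by have := ordSE i; rewrite /= => ->; case: ifP.
    + exact: height_last.
    + by rewrite lft_odd // oddD /= !odd_double.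
    + by rewrite rgt_odd // oddD /= !odd_double.
    + by rewrite lft_even // oddD /= !odd_double.
    + by rewrite rgt_even // oddD /= !odd_double.
    + exact: ordS_double.
    + exact: ordS_doubleS.
    + have cE : (if i.+1 == n then 0 else i.+1.*2)%N = (ordS i).*2.
        by rewrite ordSE; case: ifP.
      move=> k b kl bn; rewrite /corner /cell jl' eqxx cE.
      case/orP => /andP[/eqP e /eqP e'].
        have [kb|kb] := boolP (odd (k + b)).
          by move: e; rewrite lft_odd //; lia.
        move: e; rewrite lft_even // => -[->]; rewrite eqxx /=.
        apply/orP; right; apply/eqP/mod_double_lt => //.
          by have := ltn_ord (ordS i); lia.
        by rewrite e'; exact: ordS_double.
      have [kb|kb] := boolP (odd (k + b)); last first.
        by move: e; rewrite rgt_even //; lia.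
      move: e; rewrite rgt_odd // => -[->]; rewrite eqxx /=.
      by apply/orP; left; apply/eqP/mod_succ_inj => //; lia.
  have jE : ordS j = j.+1 :> nat by rewrite ordSE (negbTE jl').
  rewrite /pancake_ccw (negbTE jl') /epos.
  apply: (@in_cell_side _ j.+1.*2 i.*2.+1) => //; try exact: rad_gt0.
  + by rewrite /cell (negbTE jl') !eqxx.
  + by rewrite lft_odd // oddD /= !odd_double.
  + rewrite rgt_odd; last by rewrite oddD /= !odd_double.
    exact: (congr1 (fun m => m.*2.+1) (esym jE)).
  + exact: ordS_double.
- rewrite addrC; apply: in_cell_sym.
  apply: (@in_cell_side _ j.*2.+1 i.*2) => //; try exact: rad_gt0.
  + by rewrite /= !eqxx.
  + by rewrite lft_odd // oddD /= !odd_double.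
  + by rewrite rgt_odd // oddD /= !odd_double.
- rewrite addrC; apply: in_cell_sym.
  apply: (@in_cell_side _ j.*2.+1 (ord_pred i).*2.+1) => //; try exact: rad_gt0.
  + by rewrite /cell eqxx ord_predE /=; case: ifP => i0; apply/eqP; lia.
  + by rewrite lft_even // oddD /= !odd_double.
  + by rewrite rgt_even // oddD /= !odd_double.
  + by have := ordS_double (ord_pred i); rewrite ord_predK.
- have [j0|j0] := eqVneq (nat_of_ord j) 0%N.
    rewrite /pancake_ccw j0 eqxx /= j0.
    have h1 := rad_gt0 (Spoke i j); rewrite {1}/rad /= j0 in h1.
    rewrite /rad /= j0.
    apply: (@in_cell_cap _ 0 i.*2 i.*2.+1 1 0) => //.
    + by rewrite /cell j0 !eqxx.
    + by rewrite /cell j0 !eqxx orbT.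
    + exact: height0.
    + by rewrite lft_even // oddD /= !odd_double.
    + by rewrite rgt_even // oddD /= !odd_double.
    + by rewrite lft_odd // oddD /= !odd_double.
    + by rewrite rgt_odd // oddD /= !odd_double.
    + exact: ordS_double.
    + move=> k b kl bn; rewrite /corner /cell j0 eqxx.
      case/orP => /andP[/eqP e /eqP e'].
        have [kb|kb] := boolP (odd (k + b)); last first.
          by move: e; rewrite lft_even.
        move: e; rewrite lft_odd // => ->; rewrite eqxx /=.
        by apply/orP; right; apply/eqP/mod_double_lt => //; lia.
      have [kb|kb] := boolP (odd (k + b)); first by move: e; rewrite rgt_odd.
      move: e; rewrite rgt_even // => ->; rewrite eqxx /=.
      by apply/orP; left; apply/eqP/mod_succ_inj => //; lia.
  have jE : (ord_pred j).+1 = j by rewrite ord_predE (negbTE j0); lia.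
  rewrite /pancake_ccw (negbTE j0) /epos.
  apply: (@in_cell_side _ j.*2 i.*2) => //; try exact: rad_gt0.
  + by rewrite /cell (negbTE j0) !eqxx.
  + by rewrite lft_even // oddD /= !odd_double.
  + rewrite rgt_even; last by rewrite oddD /= !odd_double.
    exact: (congr1 double (esym jE)).
Qed.

End PancakeArcs.

(** * Links over the pancake *)

Lemma sphere_neq0 (R : realType) (x : space3 R) : sphere x -> x != 0.
Proof.
move=> /enorm_sphere; apply: contra_eqN => /eqP ->.
by rewrite /enorm big1 ?sqrtr0 1?eq_sym ?oner_eq0 // => j _; rewrite mxE expr0n.
Qed.

Lemma grid_sphere (R : realType) n l a b : sphere (grid R n l a b).
Proof.
rewrite /sphere /grid /= !big_ord_recl big_ord0 !mxE /=.
set t := _ / _; set p := _ / _.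
have := cos2Dsin2 t; have := cos2Dsin2 p => hp ht.
rewrite addr0 !exprMn addrA -mulrDr hp mulr1 addrC; exact: ht.
Qed.

Lemma sphere_scale (R : realType) (x y : space3 R) a :
  0 <= a -> sphere x -> sphere y -> x = a *: y -> x = y.
Proof.
move=> a0 /enorm_sphere ex /enorm_sphere ey xE.
by move: ex; rewrite {1}xE enormZ ey mulr1 ger0_norm // => a1;
  rewrite xE a1 scale1r.
Qed.

Lemma garc_compact (R : realType) (u v : space3 R) :
  (forall a b, 0 <= a -> 0 <= b -> a *: u + b *: v = 0 -> a = 0 /\ b = 0) ->
  compact (garc u v).
Proof.
move=> uv; pose z (t : R) := (1 - t) *: u + t *: v.
have z0 t : 0 <= t <= 1 -> z t != 0.
  move=> /andP[t0 t1]; apply/eqP => /(uv _ _ _ t0) [];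
    first by rewrite subr_ge0.
  by move=> e1 e2; lra.
have -> : garc u v = [set (enorm (z t))^-1 *: z t | t in `[0, 1]].
  apply/seteqP; split=> [x [sx [a [b [a0 b0 xE]]]]|_ [t /= t01 <-]].
    have ab : 0 < a + b.
      rewrite lt0r addr_ge0 // andbT; apply: contraTneq (sphere_neq0 sx) => ab.
      by rewrite xE; have [-> ->] : a = 0 /\ b = 0 by [split; lra];
        rewrite !scale0r addr0 eqxx.
    have zE : z (b / (a + b)) = (a + b)^-1 *: x.
      rewrite xE /z scalerDr !scalerA; congr (_ *: _ + _ *: _); field; lra.
    exists (b / (a + b)).
      rewrite /= in_itv /= divr_ge0 ?(ltW ab) //= ler_pdivrMr // mul1r; lra.
    rewrite zE enormZ (proj1 (enorm_sphere x) sx) mulr1 gtr0_norm ?invr_gt0 //.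
    by rewrite invrK scalerA divff ?scale1r // gt_eqF.
  rewrite in_itv /= in t01; have e0 := enorm_gt0 (z0 t t01).
  split.
    by apply/enorm_sphere; rewrite enormZ gtr0_norm ?invr_gt0 // mulVf ?gt_eqF.
  move/andP: t01 => [t0 t1].
  exists ((enorm (z t))^-1 * (1 - t)), ((enorm (z t))^-1 * t).
  by rewrite !mulr_ge0 ?invr_ge0 ?enorm_ge0 ?subr_ge0 // /z scalerDr !scalerA.
apply: continuous_compact; last exact: segment_compact.
apply/subspace_continuousP => t /=; rewrite in_itv /= => t01.
apply: cvg_within_filter.
have cz : z s @[s --> t] --> z t.
  apply: (@cvgD _ _ _ (nbhs t)); apply: cvgZr_tmp; last exact: cvg_id.
  by apply: (@cvgB _ _ _ (nbhs t)); [exact: cvg_cst | exact: cvg_id].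
apply: (@cvgZ _ _ _ (nbhs t)) => //.
apply: (@cvgV _ _ (nbhs t)); first by rewrite gt_eqF // enorm_gt0 // z0.
exact: (cvg_app _ (@enorm_continuous R _) cz).
Qed.

Section PancakeLink.
Variables (R : realType) (n l : nat).
Hypotheses (n_ge3 : (3 <= n)%N) (l_gt0 : (0 < l)%N).
Notation V := (space3 R).
Notation G := (pancake R n l).

Lemma cell_zero (p q b : nat) (s t : R) : 
  s *: axpt R n l p b + t *: axpt R n l q b.+1 = 0 -> s = 0 /\ t = 0.
Proof.
move=> E.
have e0 := congr1 (fun y : V => y 0 0) E.
have e1 := congr1 (fun y : V => y 0 1) E.
rewrite !mxE /= in e0 e1.
have g1 : 0 < sin (lon R n 1) by apply: sin_lon_gt0; lia.
have tz : t = 0.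
  have : t * sin (lon R n 1) = 0.
    rewrite -(det_lon R n_ge3 b 1) addn1.
    have := congr2 (fun u v => cos (lon R n b) * v - sin (lon R n b) * u) e0 e1.
    by rewrite !mulr0; lra.
  by move=> /eqP; rewrite mulf_eq0 (gt_eqF g1) orbF => /eqP.
split => //; rewrite tz !mul0r !addr0 in e0 e1.
have := cos2Dsin2 (lon R n b) => cs.
have := congr2 (fun u v => cos (lon R n b) * u + sin (lon R n b) * v) e0 e1.
rewrite !mulr0 addr0 => <-.
rewrite -[LHS]mulr1 -cs; ring.
Qed.

Lemma ept_sphere e : sphere (@ept R G e).
Proof. by rewrite eptE; exact: grid_sphere. Qed.

Lemma med_arc_end (d d' : dart G) x : d != d' -> med_arc d x -> med_arc d' x ->
  x = ept d.1 \/ x = ept (ccw d).1.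
Proof.
move=> dd' [sx [u [v [u0 v0 xE]]]] [_ [u' [v' [u'0 v'0 xE']]]].
have x0 := sphere_neq0 sx.
have [k [b [s [t [Ckb s0 t0 sE [hs ht _]]]]]] :=
  med_arc_in_cell n_ge3 l_gt0 d u0 v0.
have [k' [b' [s' [t' [Ckb' s'0 t'0 s'E _]]]]] :=
  med_arc_in_cell n_ge3 l_gt0 d' u'0 v'0.
have [kl bn] := cell_bound n_ge3 l_gt0 Ckb;
  have [k'l b'n] := cell_bound n_ge3 l_gt0 Ckb'.
have alt : [\/ u = 0, v = 0 | cell d k' b'] -> x = ept d.1 \/ x = ept (ccw d).1.
  case=> [uz|vz|/(cell_inj n_ge3 l_gt0 Ckb') e].
  - right; apply: (sphere_scale v0 sx (ept_sphere _)).
    by rewrite xE uz scale0r add0r.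
  - left; apply: (sphere_scale u0 sx (ept_sphere _)).
    by rewrite xE vz scale0r addr0.
  - by rewrite e eqxx in dd'.
rewrite -xE in sE; rewrite -xE' in s'E.
have [[kk bb]|[sz cor]|[tz cor]] :=
  cell_meet n_ge3 l_gt0 x0 kl k'l bn b'n s0 t0 s'0 t'0 sE s'E.
- by apply: alt; constructor 3; rewrite -kk -bb.
- apply: alt; case: (hs sz) => [?|?|m]; [by constructor 1|by constructor 2|].
  by constructor 3; exact: m.
- apply: alt; case: (ht tz) => [?|?|m]; [by constructor 1|by constructor 2|].
  by constructor 3; exact: m.
Qed.

Lemma pancake_arc_system :
  arc_system (@med_arc R G) (fun d => d.1) (fun d => (ccw d).1) (@ept R G).
Proof.
have st (x : V) u v : u = x \/ v = x -> sphere x -> garc u v x.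
  by move=> [->|->] sx; split => //; [exists 1, 0|exists 0, 1];
    rewrite scale1r scale0r ?addr0 ?add0r.
split.
- move=> d; apply: garc_compact => u v u0 v0 e.
  have [k [b [s [t [_ _ _ sE [_ _ h]]]]]] :=
    med_arc_in_cell n_ge3 l_gt0 d u0 v0.
  by rewrite e in sE; have [sz tz] := cell_zero (esym sE); exact: h.
- exact: ept_inj.
- by move=> d; apply: st; [left | exact: ept_sphere].
- by move=> d; apply: st; [right | exact: ept_sphere].
- by move=> d; rewrite eq_sym; exact: (pancake_ccw_edge n_ge3 l_gt0 d).
- by move=> e; exists (e, false).
- by move=> e; exists (pancake_cw (e, false));
    exact: (congr1 fst (pancake_cwK n_ge3 l_gt0 (e, false))).
- move=> d d' x dd' dx d'x.
  have ex : exists2 e, x = ept e & (e == d.1) || (e == (ccw d).1).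
    by case: (med_arc_end dd' dx d'x) => ->; eexists => //; rewrite eqxx ?orbT.
  case: ex => e xE h; exists e; split => //; rewrite xE in d'x dx.
  rewrite eq_sym in dd'; have := med_arc_end dd' d'x dx.
  by move=> [/(ept_inj n_ge3 l_gt0) ->|/(ept_inj n_ge3 l_gt0) ->];
    rewrite eqxx ?orbT.
Qed.

Lemma lies_over_heights (S : edge G -> sign) K : lies_over S K ->
  exists (h : dart G -> V -> R) (T : edge G -> bool -> R),
    [/\ forall d x, med_arc d x -> 0 < h d x,
        K = \bigcup_(d in [set: dart G]) [set h d x *: x | x in med_arc d],
        arc_heights (@med_arc R G) (fun d => d.1) (fun d => (ccw d).1)
          (@ept R G) (fun d x => ln (h d x)) T &
        forall e, T e (if S e is Plus then false else true) <
                  T e (if S e is Plus then true else false)].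
Proof.
case=> h [ch h0 hX KE].
pose c (d : dart G) : dart G := @pancake_cw n l d.
have cK d : ccw (c d) = d := pancake_cwK n_ge3 l_gt0 d.
have Kc d : c (ccw d) = d := pancake_ccwK n_ge3 l_gt0 d.
have sA := pancake_arc_system.
exists h, (fun e b => ln (h (if b then (e, false) else c (e, false)) (ept e))).
have X e := hX (c (e, false)) (e, false) (c (flip (e, false))) (cK _) (cK _).
split => //; [split|].
- move=> d; apply/subspace_continuousP => x dx.
  have /subspace_continuousP/(_ x dx) chx := ch d.
  by apply: (cvg_app _ _ chx); apply: continuous_ln; exact: h0.
- by case=> e [] //=; have [-> _ _] := X e.
- move=> d; case E: (ccw d) => [e b] /=; rewrite -[d]Kc E.
  by case: b E => E //; have [_ -> _] := X e.
- move=> e; have [_ _] := X e => /=.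
  have pc := h0 _ _ (arc_tgt sA (c (e, false))); rewrite cK /= in pc.
  have pd := h0 _ _ (arc_src sA (e, false)); rewrite /= in pd.
  by case: (S e) => lt_h; rewrite ltr_ln ?posrE.
Qed.

Lemma lies_over_equivalent (S : edge G -> sign) K K' :
  lies_over S K -> lies_over S K' -> equivalent K K'.
Proof.
case/lies_over_heights => h [T [h0 -> hT Tlt]].
case/lies_over_heights => h' [T' [h'0 -> hT' T'lt]].
have [e|d0 sd dE] := arc_interpolation pancake_arc_system hT hT'.
  exists (if S e is Plus then true else false).
  by have := Tlt e; have := T'lt e; case: (S e).
have rE d x : med_arc d x -> radial d0 (h d x *: x) = h' d x *: x.
  move=> dx; rewrite radial_sphere; [|by case: dx|exact: h0].
  by rewrite dE // addrC subrK lnK // posrE; exact: h'0.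
suff <- : radial d0 @` (\bigcup_(d in [set: dart G])
    [set h d x *: x | x in med_arc d]) =
  \bigcup_(d in [set: dart G]) [set h' d x *: x | x in med_arc d].
  exact: radial_equivalent.
apply/seteqP; split=> [_ [_ [d _ [x dx <-]] <-]|_ [d _ [x dx <-]]].
  by exists d => //; exists x => //; rewrite rE.
by exists (h d x *: x); [exists d => //; exists x | rewrite rE].
Qed.

Lemma lies_over_antipode (S : edge G -> sign) K : odd n ->
  (forall v w : edge G, ept w = - ept v -> S v = S w) ->
  lies_over S K -> lies_over S (@antipode R @` K).
Proof.
move=> on Sa [h [ch h0 hX KE]].
have [a [aK aE _ aC]] := @pancake_antipode R n l on.
have [b bK] := choice aK.
have Kb : cancel a b.
  have [g ga ag] := injF_bij (can_inj bK).
  by move=> d; rewrite -[d]ag bK.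
have ptI := @ept_inj R n l n_ge3 l_gt0.
have arcE d x : med_arc (a d) x <-> med_arc d (- x).
  rewrite /med_arc -aE -aC; split=> /garcN; rewrite ?opprK //.
have ccwI : injective (@ccw R G) := can_inj (pancake_ccwK n_ge3 l_gt0).
have bE d : @ept R G d.1 = - ept (b d).1 by rewrite aE bK.
have bC d : @ept R G (ccw d).1 = - ept (ccw (b d)).1 by rewrite aC bK.
have edge_flip (d d' : dart G) : d.1 = d'.1 -> d' = d \/ d' = flip d.
  by case: d d' => [e []] [e' []] /= ->; [left|right|right|left].
have flipK (d : dart G) : flip (flip d) = d by case: d => [e []].
have flip_neq (d : dart G) : flip d != d by case: d => [e []];
  rewrite xpair_eqE andbF.
have edge_b (d d' : dart G) : d.1 = d'.1 -> (b d).1 = (b d').1.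
  by move=> dd; apply: ptI; apply: oppr_inj; rewrite -!bE dd.
have bflip d : b (flip d) = flip (b d).
  case: (edge_flip (b d) (b (flip d)) (edge_b d (flip d) erefl)) => //.
  by move=> /(can_inj bK) /eqP; rewrite (negbTE (flip_neq d)).
have ccw_b (c d : dart G) : ccw c = d ->
  ccw (b c) = b d \/ ccw (b c) = flip (b d).
  move=> cd; apply: edge_flip; apply: ptI; apply: oppr_inj.
  by rewrite -bE -bC cd.
have cc_neq (c c' d : dart G) : ccw c = d -> ccw c' = flip d ->
    ccw (b c) <> ccw (b c').
  move=> cd c'd /ccwI /(can_inj bK) cc; move: c'd; rewrite -cc cd => /eqP.
  by rewrite eq_sym (negbTE (flip_neq d)).
exists (fun d x => h (b d) (- x)); split.
- move=> d; apply/subspace_continuousP => x dx.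
  have ax : med_arc (b d) (- x) by apply/arcE; rewrite bK.
  have /subspace_continuousP/(_ _ ax) cx := ch (b d).
  move=> U nU.
  have hU : \forall y \near - x, med_arc (b d) y -> U (h (b d) y) := cx U nU.
  have cN : -%R @ x --> - x by exact: (@oppr_continuous _ V x).
  have hU' : \forall y \near x, med_arc (b d) (- y) -> U (h (b d) (- y)) :=
    cN _ hU.
  have hB : \forall y \near x, med_arc d y -> U (h (b d) (- y)).
    by apply: filterS hU' => y Uy dy; apply: Uy; apply/arcE; rewrite bK.
  exact: hB.
- by move=> d x; rewrite -{1}[d]bK => /arcE; exact: h0.
- move=> c d c' cd c'd v.
  have vE : - v = ept (b d).1 by rewrite /v bE opprK.
  have SE : S d.1 = S (b d).1 by apply: Sa; rewrite [in RHS]bE opprK.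
  rewrite /= vE bflip SE.
  have [e|e] := ccw_b _ _ cd; have [e'|e'] := ccw_b _ _ c'd;
    rewrite bflip ?flipK in e'.
  + exact: (hX (b c) (b d) (b c') e e').
  + by case: (cc_neq _ _ _ cd c'd); rewrite e e'.
  + by case: (cc_neq _ _ _ cd c'd); rewrite e e'.
  + have := hX (b c) (flip (b d)) (b c') e; rewrite flipK => /(_ e') [-> -> X].
    split => //; exact: X.
- rewrite KE; apply/seteqP; split=> [_ [_ [d _ [x dx <-]] <-]|_ [d _ [x dx
    <-]]].
    exists (a d) => //; exists (- x); last by rewrite opprK Kb scalerN.
    by apply/arcE; rewrite opprK.
  exists (h (b d) (- x) *: - x); last by rewrite /antipode scalerN opprK.
  by exists (b d) => //; exists (- x) => //; apply/arcE; rewrite bK.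
Qed.

End PancakeLink.

Theorem corollary6 (R : realType) (n l : nat) (SE : edge (pancake R n l) -> sign)
    (L : set (space3 R)) :
  (3 <= n)%N -> (1 <= l)%N -> odd n ->
  (forall v w : edge (pancake R n l), ept w = - ept v -> SE v = SE w) ->
  represents SE L -> amphichiral L.
Proof.
move=> n3 l1 on Sa [K KS KL].
apply: (equivalent_trans (equivalent_sym KL)).
apply: (equivalent_trans _ (equivalent_mirror KL)).
apply: (equivalent_trans _ (equivalent_antipode_mirror K)).
exact: (lies_over_equivalent n3 l1 KS (lies_over_antipode n3 l1 on Sa KS)).
Qed.
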